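(* Let $(Z,\omega)$ be a nontrivial deformation datum on $\mathbb P^1_k$ with $r$ singularities $x_1,\dots,x_r$ and $d$ supersingular points, let $\alpha_i\in\mathbb F_p$ be the residue class of $\sigma_{x_i}$ modulo $p$ ($1\le i\le r$), and let $n$ be its strength. Then (a) $n=(r-2)(p-1)-2d$; (b) $n$ is an even integer with $n\equiv-\sum_{i=1}^r\alpha_i\pmod p$; (c) $n\ge\sum_{i:\,\alpha_i\ne0}(p-\alpha_i)$, where in the sum $\alpha_i$ is identified with its representative in $\{1,\dots,p-1\}$.
   Context: Let $k$ be an algebraically closed field of characteristic $p>2$ and $X=\mathbb P^1_k$. A deformation datum on $X$ is a pair $(Z,\omega)$ with $g:Z\to X$ a finite Galois cover of smooth projective curves, with group $H$, and $\omega$ a meromorphic differential form on $Z$ which is logarithmic ($\omega=df/f$ for some $f\in k(Z)^\times$) and satisfies $\beta^*\omega=\chi(\beta)\omega$ for all $\beta\in H$, where $\chi:H\to\mathbb F_p^\times$ is an injective character. For a closed point $x\in X$ and $z\in Z$ above $x$ put $\sigma_x=(\mathrm{ord}_z(\omega)+1)/|H_z|\in\frac1{p-1}\mathbb Z$, where $H_z$ is the stabilizer of $z$. The point $x$ is critical if $\sigma_x\ne1$. A critical point is supersingular if $\sigma_x=(p+1)/(p-1)$, a spike if $\sigma_x\equiv1\pmod p$, and a singularity if it is neither supersingular nor a spike. The datum is trivial if it has exactly $2$ singularities. The strength of the datum is $n=\sum_x n_x$ over critical points $x$, where $n_x=0$ if $x$ is supersingular, $n_x=(p-1)\sigma_x$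 if $x$ is a singularity, and $n_x=(p-1)(\sigma_x-1)$ if $x$ is a spike. Such deformation data (with $x_r=\infty$) correspond to normalized second order Fuchsian differential operators on $\mathbb P^1_k$ with nilpotent and nonzero $p$-curvature, singularities $x_1,\dots,x_r$ and local exponents $\{0,\alpha_i\}$ at $x_i$ for $i\neq r$ and $\{-d,-d+\alpha_r\}$ at $x_r=\infty$, where $d$ is the degree of the minimal polynomial solution, whose zeros are the supersingular points; the strength of the operator is that of the datum. *)

(* Defs.v *)
From HB Require Import structures.
From mathcomp Require Import all_boot all_order all_algebra all_fingroup all_field.
From mathcomp Require Import all_classical.
Set Implicit Arguments.
Unset Strict Implicit.
Unset Printing Implicit Defensive.
Import Order.TTheory GRing.Theory Num.Theory.
Local Open Scope classical_set_scope.
Local Open Scope ring_scope.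

(* A finite Galois cover g : Z -> P^1_k of smooth projective (connected) curves
   is given by its function field extension L / k(t), where k(t) is
   {fraction {poly k}} and L = k(Z); its group is H = 'Gal(L / k(t)), acting on
   L by beta^*. *)

Section DeformationData.

Variable k : closedFieldType.
Variable L : splittingFieldType {fraction {poly k}}.

Definition cst (c : k) : L := (tofrac c%:P)%:A.

Definition coord : L := (tofrac ('X : {poly k}))%:A.

(* The closed points of Z are the discrete valuations of L, trivial on k, with
   value group int.  The value at 0, mathematically +oo, is set to 0. *)
Definition is_point (v : L -> int) : Prop :=
  [/\ forall f g, f != 0 -> g != 0 -> v (f * g) = v f + v g,
      forall f g, f != 0 -> g != 0 -> f + g != 0 ->
        Num.min (v f) (v g) <= v (f + g),
      forall c, v (cst c) = 0,
      exists s, v s = 1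
    & v 0 = 0].

(* The closed points of P^1_k are the elements of option k, None being
   infinity. *)
Definition local_param (x : option k) : L :=
  if x is Some a then coord - cst a else coord^-1.

Definition lies_above (v : L -> int) (x : option k) : Prop :=
  0 < v (local_param x).

Definition stabilizer (v : L -> int) : {set gal_of {:L}} :=
  finset (fun b : gal_of {:L} =>
    (b \in 'Gal({:L} / 1)%g) && `[< forall f, v (b f) = v f >]).

Definition is_derivation (V : lmodType L) (D : L -> V) : Prop :=
  [/\ forall f g, D (f + g) = D f + D g,
      forall f g, D (f * g) = f *: D g + g *: D f
    & forall c, D (cst c) = 0].

(* (Om, d) is the module of Kaehler differentials of L / k, that is, the module
   of meromorphic differential forms on Z. *)
Definition is_kaehler (Om : lmodType L) (d : L -> Om) : Prop :=
  is_derivation d /\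
  forall (V : lmodType L) (D : L -> V), is_derivation D ->
    exists phi : {linear Om -> V},
      (forall f, phi (d f) = D f) /\
      (forall psi : {linear Om -> V}, (forall f, psi (d f) = D f) ->
         psi =1 phi).

Section Forms.

Variables (Om : lmodType L) (d : L -> Om).

(* phi is the map beta^* on forms, f dg |-> b(f) d(b(g)); it exists and is
   unique when (Om, d) is the module of Kaehler differentials. *)
Definition is_pullback (b : gal_of {:L}) (phi : Om -> Om) : Prop :=
  (forall u w, phi (u + w) = phi u + phi w) /\
  (forall f g, phi (f *: d g) = b f *: d (b g)).

Definition logarithmic (omega : Om) : Prop :=
  exists2 f : L, f != 0 & omega = f^-1 *: d f.

Definition is_deformation_datum (p : nat) (omega : Om) : Prop :=
  [/\ galois 1%AS {:L}, omega != 0, logarithmic omega &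
      exists2 chi : {morphism 'Gal({:L} / 1)%g >-> {unit 'F_p}}, ('injm chi)%g &
        forall b, b \in 'Gal({:L} / 1)%g ->
          exists2 phi, is_pullback b phi &
            phi omega = ((val (chi b) : 'F_p) : nat)%:R *: omega].

(* If omega = f ds with s a uniformizer at v, then omega has order v(f). *)
Definition ord (v : L -> int) (omega : Om) : int :=
  xget 0 [set m : int |
    exists s f : L, [/\ v s = 1, f != 0, omega = f *: d s & m = v f]].

(* The value does not depend on the point v of Z above x. *)
Definition sigma (omega : Om) (x : option k) : rat :=
  xget 0 [set q : rat |
    exists v : L -> int, [/\ is_point v, lies_above v x
      & q = (ord v omega + 1)%:~R / #|stabilizer v|%:R]].

Variables (p : nat) (omega : Om).

Definition critical (x : option k) : Prop := sigma omega x <> 1.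

Definition supersingular (x : option k) : Prop :=
  critical x /\ sigma omega x = (p%:R + 1) / (p%:R - 1).

(* sigma_x lies in (1 / (p - 1)) Z, so ratr sends it to its residue class. *)
Definition residue (x : option k) : 'F_p := ratr (sigma omega x).

Definition spike (x : option k) : Prop := critical x /\ residue x = 1.

Definition singularity (x : option k) : Prop :=
  [/\ critical x, ~ supersingular x & ~ spike x].

Definition trivial_datum : Prop := ([set x | singularity x] #= `I_2)%card.

Definition local_strength (x : option k) : rat :=
  if `[< supersingular x >] then 0
  else if `[< spike x >] then (p%:R - 1) * (sigma omega x - 1)
  else (p%:R - 1) * sigma omega x.

Definition strength : rat :=
  \sum_(x \in [set x | critical x]) local_strength x.

End Forms.

End DeformationData.

(* Main.v *)
Require Import Defs.
From HB Require Import structures.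
From mathcomp Require Import all_boot all_order all_algebra all_fingroup all_field.
From mathcomp Require Import all_classical.
From mathcomp Require Import cyclic.
From mathcomp Require Import zify ring.
Set Implicit Arguments.
Unset Strict Implicit.
Unset Printing Implicit Defensive.
Import Order.TTheory GRing.Theory Num.Theory.
Local Open Scope classical_set_scope.
Local Open Scope ring_scope.

(** Write [omega = u dt] with [u] in the function field [L] of [Z]. The group acts
    on [u] through the injective character, so [L = k(t)(u)] is a tame Kummer
    extension, and [u ^+ (p - 1) = F] is a rational function. At a place [v] above
    [x] with ramification index [e], the form [dt] has order [e - 1], or [- e - 1]
    at infinity, and [(p - 1) v(u) = e ord_x(F)]; since the stabilizer of [v] has
    order [e], this gives [sigma_x = 1 + N_x / (p - 1)] with [N_x = ord_x(F)], or
    [ord_x(F) - 2 (p - 1)] at infinity.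

    As [F] has degree 0, the sum of the [N_x] is [- 2 (p - 1)]. The local strength
    is [0 = N_x - 2] at a supersingular point, [N_x] at a spike and
    [N_x + (p - 1)] at a singularity, and summing gives (a). Parity follows since
    [p - 1] is even, and the congruence of (b) since the residue class of
    [sigma_x] is [1 - N_x]. Finally a logarithmic form has at most simple poles,
    so [sigma_x >= 0]: local strengths are nonnegative, and at a singularity the
    local strength, being congruent to [- alpha], is at least [p - alpha] unless
    [alpha = 0], which is (c).

    The work lies in the places of a Kummer extension. That the stabilizer has
    order [e] ([card_stabilizer]) and that the derivation attached to a local
    parameter of the base preserves orders ([th_integral], [val_th_uniformizer])
    are proved inside [L], without completing: a function that is a unit at [v]
    and vanishes at the conjugates of [v] ([separating_function]) reduces both
    statements to the Kummer components of a function, with coefficients in the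
    base. Places above a given point exist ([place_exists]) because the Kummer
    equation can be solved by Newton approximation in [k(t)] after a ramified
    change of the coordinate, and the orders of the approximate values of an
    element of [L] are eventually constant ([limit_valuation]). *)

(** * Discrete valuations *)

Lemma eq_of_dvd_dist (q i j : nat) : (i < q)%N -> (j < q)%N ->
  (q %| `|i%:Z - j%:Z|)%N -> i = j.
Proof.
move=> iq jq /dvdnP[[|n] hn]; first by move: hn; rewrite mul0n; lia.
have : (q <= `|i%:Z - j%:Z|)%N by rewrite hn mulSn leq_addr.
lia.
Qed.

Section Valuation.

Variable E : fieldType.

Definition valuation (v : E -> int) : Prop :=
  [/\ forall f g, f != 0 -> g != 0 -> v (f * g) = v f + v g,
      forall f g, f != 0 -> g != 0 -> f + g != 0 ->
        Num.min (v f) (v g) <= v (f + g)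
    & v 0 = 0].

(** Order at least [n], with the order of 0 read as infinite; the value [v 0]
    itself is a dummy. *)
Definition vge (v : E -> int) (n : int) (y : E) : bool := (y == 0) || (n <= v y).

Variable v : E -> int.
Hypothesis hv : valuation v.

Lemma valM f g : f != 0 -> g != 0 -> v (f * g) = v f + v g.
Proof. by case: hv => + _ _; apply. Qed.

Lemma val1 : v 1 = 0.
Proof.
by apply: (@addrI _ (v 1)); rewrite -valM ?oner_neq0 // mulr1 addr0.
Qed.

Lemma valN f : v (- f) = v f.
Proof.
have [->|f0] := eqVneq f 0; first by rewrite oppr0.
have n1 : (-1 : E) != 0 by rewrite oppr_eq0 oner_eq0.
have v1 : v (-1) + v (-1) = 0 by rewrite -valM // mulrNN mulr1 val1.
by rewrite -mulN1r valM //; lia.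
Qed.

Lemma valV f : v f^-1 = - v f.
Proof.
have [->|f0] := eqVneq f 0; first by case: hv => _ _ v0; rewrite invr0 v0.
by apply: (@addrI _ (v f)); rewrite -valM ?invr_neq0 // divff // val1 subrr.
Qed.

Lemma valX f n : f != 0 -> v (f ^+ n) = n%:Z * v f.
Proof.
move=> f0; elim: n => [|n IH]; first by rewrite expr0 val1 mul0r.
by rewrite exprS valM ?expf_neq0 // IH; lia.
Qed.

Lemma valXz f (n : int) : f != 0 -> v (f ^ n) = n * v f.
Proof. by move=> f0; case: n => n; rewrite ?NegzE /= ?exprnP ?valV valX //; lia. Qed.

Lemma vge0 n : vge v n 0. Proof. by rewrite /vge eqxx. Qed.

Lemma vgeE n y : y != 0 -> vge v n y = (n <= v y).
Proof. by rewrite /vge => /negPf ->. Qed.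

Lemma vge_val y : vge v (v y) y.
Proof. by rewrite /vge lexx orbT. Qed.

Lemma vge_le m n y : m <= n -> vge v n y -> vge v m y.
Proof. by rewrite /vge => mn /orP[->//|ny]; rewrite (le_trans mn ny) orbT. Qed.

Lemma vgeD n f g : vge v n f -> vge v n g -> vge v n (f + g).
Proof.
rewrite /vge; have [->|f0] := eqVneq f 0; first by rewrite add0r.
have [->|g0] := eqVneq g 0; first by rewrite addr0 => /= ->; rewrite orbT.
have [//|s0] /= := eqVneq (f + g) 0.
move=> nf ng; case: hv => _ /(_ f g f0 g0 s0) + _; apply: le_trans.
by rewrite le_min nf.
Qed.

Lemma vgeN n f : vge v n (- f) = vge v n f.
Proof. by rewrite /vge oppr_eq0 valN. Qed.

Lemma vgeB n f g : vge v n f -> vge v n g -> vge v n (f - g).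
Proof. by move=> nf ng; rewrite vgeD ?vgeN. Qed.

Lemma vge_sum I (r : seq I) (P : pred I) (F : I -> E) n :
  (forall i, P i -> vge v n (F i)) -> vge v n (\sum_(i <- r | P i) F i).
Proof. by move=> h; apply: (big_ind (vge v n)); [exact: vge0|exact: vgeD|]. Qed.

Lemma vgeM m n f g : vge v m f -> vge v n g -> vge v (m + n) (f * g).
Proof.
rewrite /vge mulf_eq0; have [//|f0] := eqVneq f 0; have [//|g0] /= := eqVneq g 0.
by rewrite valM //; apply: lerD.
Qed.

Lemma vgeMl n f g : vge v 0 f -> vge v n g -> vge v n (f * g).
Proof. by move=> /vgeM h /h; rewrite add0r. Qed.

Lemma vge_prod I (r : seq I) (P : pred I) (F : I -> E) :
  (forall i, P i -> vge v 0 (F i)) -> vge v 0 (\prod_(i <- r | P i) F i).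
Proof.
move=> h; apply: (big_ind (vge v 0)) => //; first by rewrite /vge val1 lexx orbT.
by move=> f g hf hg; apply: vgeMl.
Qed.

Lemma val_prod0 I (r : seq I) (P : pred I) (F : I -> E) :
  (forall i, P i -> F i != 0 /\ v (F i) = 0) ->
  \prod_(i <- r | P i) F i != 0 /\ v (\prod_(i <- r | P i) F i) = 0.
Proof.
move=> h; apply: (big_ind (fun y => y != 0 /\ v y = 0)) => //.
- by rewrite oner_neq0 val1.
- by move=> f g [f0 vf] [g0 vg]; rewrite mulf_neq0 // valM // vf vg.
Qed.

Lemma valD_dominant f g : f != 0 -> vge v (v f + 1) g -> f + g != 0 /\ v (f + g) = v f.
Proof.
move=> f0 hg; have [->|g0] := eqVneq g 0; first by rewrite addr0.
have hg' : v f < v g by move: hg; rewrite vgeE //; lia.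
have s0 : f + g != 0.
  by apply: contraTneq hg' => /eqP; rewrite addr_eq0 => /eqP ->; rewrite valN ltxx.
split=> //; have le1 : v f <= v (f + g).
  by have := vgeD (vge_val f) (vge_le (ltW hg') (vge_val g)); rewrite vgeE.
apply/eqP; rewrite eq_le le1 andbT; have [//|lt2] := leP (v (f + g)) (v f).
have := vgeB (vge_le _ (vge_val (f + g))) hg; rewrite addrK vgeE //.
move/(_ ltac:(lia)); lia.
Qed.

(** Terms of pairwise distinct orders cannot cancel: the one of least order
    dominates the sum of the others. *)
Lemma val_sum_distinct (I : finType) (F : I -> E) :
  (forall i j, F i != 0 -> F j != 0 -> v (F i) = v (F j) -> i = j) ->
  \sum_i F i != 0 ->
  exists i, [/\ F i != 0, v (\sum_i F i) = v (F i) & forall j, vge v (v (F i)) (F j)].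
Proof.
move=> inj s0.
have /existsP[i0 Fi0] : [exists i, F i != 0].
  apply: contraNT s0; rewrite negb_exists => /forallP h; rewrite big1 // => i _.
  by have := h i; rewrite negbK => /eqP.
case: (@arg_minP _ _ _ i0 (fun i => F i != 0) (fun i => v (F i)) Fi0) => i Fi0' imin.
have hmin j : vge v (v (F i)) (F j).
  by have [->|Fj] := eqVneq (F j) 0; [exact: vge0 | rewrite vgeE // imin].
exists i; split=> //; rewrite (bigD1 i) //=.
apply: (valD_dominant Fi0' _).2; apply: vge_sum => j nji.
have [->|Fj] := eqVneq (F j) 0; first exact: vge0.
have : v (F i) != v (F j) by apply: contra_neq nji => /(inj _ _ Fi0' Fj) ->.
by have := hmin j; rewrite !vgeE //; lia.
Qed.

End Valuation.
(** * Kummer extensions *)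

Section Kummer.

Variables (k : closedFieldType) (K : fieldType) (L : splittingFieldType K).
Variable c : {rmorphism k -> L}.
Hypothesis c1 : forall a, c a \in 1%VS.
Hypothesis galL : galois 1%AS {:L}.

Local Notation H := ('Gal({:L} / 1)%g).

Lemma gal_const b a : b \in H -> b (c a) = c a.
Proof. by move=> bH; apply: (fixed_gal _ bH); rewrite ?sub1v. Qed.

Lemma gal_comp (b b' : gal_of {:L}) y : (b * b')%g y = b' (b y).
Proof. by rewrite galM ?memvf. Qed.

Lemma gal_fixed y : (forall b, b \in H -> b y = y) -> y \in 1%VS.
Proof.
move=> h; have /galois_fixedField fixL := galL.
have : y \in fixedField H by apply/fixedFieldP; rewrite ?memvf.
by rewrite fixL.
Qed.

(** [u] is a Kummer generator: a simultaneous eigenvector of the Galois group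
    whose eigenvalues [X b] separate the automorphisms. *)
Variables (u : L) (X : gal_of {:L} -> k).
Hypothesis u0 : u != 0.
Hypothesis hX : forall b, b \in H -> b u = c (X b) * u.
Hypothesis Xinj : {in H &, injective X}.
Hypothesis hm : (#|H|%:R : k) != 0.

Lemma X_neq0 b : b \in H -> X b != 0.
Proof.
move=> bH; apply: contraNneq u0 => X0; have := hX bH.
by rewrite X0 rmorph0 mul0r => /eqP; rewrite fmorph_eq0.
Qed.

Lemma XM : {in H &, {morph X : b b' / (b * b')%g >-> b * b'}}.
Proof.
move=> b b' bH b'H; apply: (fmorph_inj c); apply: (mulIf u0).
rewrite -hX ?groupM // gal_comp (hX bH) [LHS]rmorphM /= gal_const //.
by rewrite (hX b'H) [c (_ * _)]rmorphM mulrA.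
Qed.

Lemma X1 : X 1%g = 1.
Proof.
by apply: (fmorph_inj c); apply: (mulIf u0); rewrite -hX // gal_id rmorph1 mul1r.
Qed.

Lemma X_eq1 b : b \in H -> (X b == 1) = (b == 1%g).
Proof.
move=> bH; apply/eqP/eqP => [Xb|->]; last exact: X1.
by apply: Xinj => //; rewrite Xb X1.
Qed.

Lemma XX b n : b \in H -> X (b ^+ n)%g = X b ^+ n.
Proof.
by move=> bH; elim: n => [|n IH]; rewrite ?expg0 ?X1 // expgS XM ?groupX // IH exprS.
Qed.

Lemma X_card (D : {group gal_of {:L}}) b : D \subset H -> b \in D -> X b ^+ #|D| = 1.
Proof.
move=> /fintype.subsetP DH bD; rewrite -XX ?DH //.
have /eqP -> : (b ^+ #|D| == 1)%g by rewrite -order_dvdn order_dvdG.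
exact: X1.
Qed.

Lemma kummer_cyclic : cyclic H.
Proof.
apply: (@field_mul_group_cyclic _ [group of H] _ X) => [b b' bH b'H|b bH].
  exact: XM.
split=> [Xb|->]; last exact: X1.
by apply/eqP; rewrite -X_eq1 ?Xb ?eqxx.
Qed.

Lemma X_expn_group_set q : group_set [set b in H | X b ^+ q == 1].
Proof.
apply/group_setP; split=> [|b b']; first by rewrite inE group1 X1 expr1n eqxx.
rewrite !inE => /andP[bH /eqP Xb] /andP[b'H /eqP Xb'].
by rewrite groupM // XM // exprMn Xb Xb' mulr1 eqxx.
Qed.

(** For a suitable [q] this subgroup is the stabilizer of a place. *)
Canonical X_torsion q := Group (X_expn_group_set q).

Lemma X_torsion_sub q : X_torsion q \subset H.
Proof. by apply/fintype.subsetP => b; rewrite inE => /andP[]. Qed.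

Lemma card_X_torsion q : (0 < q)%N -> (q %| #|H|)%N -> #|X_torsion q| = q.
Proof.
move=> q0 qm; apply/eqP; rewrite eqn_leq; apply/andP; split.
  pose P : {poly k} := 'X^q - 1.
  have P0 : P != 0 by rewrite monic_neq0 // monicXnsubC.
  have rs : all (root P) [seq X b | b <- enum (X_torsion q)].
    apply/allP => _ /mapP[b + ->]; rewrite mem_enum inE => /andP[_ /eqP Xb].
    by rewrite /root !hornerE Xb subrr.
  have us : uniq [seq X b | b <- enum (X_torsion q)].
    rewrite map_inj_in_uniq ?enum_uniq // => b b'; rewrite !mem_enum !inE.
    by move=> /andP[bH _] /andP[b'H _]; apply: Xinj.
  by have := max_poly_roots P0 rs us; rewrite size_map -cardE size_XnsubC // ltnS.
have /cyclicP[a Ha] := kummer_cyclic.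
have qa : (q %| #[a]%g)%N by rewrite /order -Ha.
have /finset.setP/(_ <[a ^+ (#[a]%g %/ q)%N]>%G) := cycle_sub_group qa.
rewrite !inE eqxx => /andP[sub /eqP cq].
rewrite -{1}cq; apply/subset_leq_card/fintype.subsetP => b bD; rewrite inE.
have bH : b \in H by rewrite Ha; apply: (fintype.subsetP sub).
by rewrite bH -cq X_card ?eqxx // Ha.
Qed.

Lemma card_neq0 (D : {group gal_of {:L}}) : D \subset H -> (#|D|%:R : k) != 0.
Proof.
move=> DH; apply: contraNneq hm => D0.
by rewrite -(Lagrange DH) natrM D0 mul0r.
Qed.

Lemma sum_character (D : {group gal_of {:L}}) b : D \subset H -> b \in D ->
  \sum_(j < #|D|) X b ^- j = (if b == 1%g then #|D|%:R else 0).
Proof.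
move=> DH bD; have bH := fintype.subsetP DH b bD; case: eqP => [->|/eqP b1].
  under eq_bigr do rewrite X1 expr1n invr1.
  by rewrite sumr_const card_ord.
under eq_bigr do rewrite -exprVn.
have nz : (X b)^-1 - 1 != 0 by rewrite subr_eq0 invr_eq1 X_eq1.
apply: (mulfI nz); rewrite -subrX1 exprVn X_card //.
by rewrite invr1 subrr mulr0.
Qed.

(** The coefficients are averages of conjugates of [y] twisted by powers of the
    character, hence they inherit any bound on the orders of these conjugates. *)
Lemma eigen_decomposition (D : {group gal_of {:L}}) y : D \subset H ->
  exists z : nat -> L,
  [/\ y = \sum_(j < #|D|) z j * u ^+ j,
      forall j b, b \in D -> b (z j) = z j
    & forall v n, valuation v -> (forall a, v (c a) = 0) ->
        (forall b, b \in D -> vge v n (b y)) -> forall j, vge v n (z j * u ^+ j)].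
Proof.
move=> DH; have q0 := card_neq0 DH; set q := #|D| in q0 *.
have inH b : b \in D -> b \in H by apply: (fintype.subsetP DH).
pose s j : L := \sum_(b in D) c (X b ^- j) * b y.
pose z j := c q%:R^-1 * s j * u ^- j.
have zu j : z j * u ^+ j = c q%:R^-1 * s j by rewrite /z mulfVK // expf_neq0.
exists z; split=> [|j b bD|v n hv vc hy j].
- under eq_bigr do rewrite zu.
  rewrite -mulr_sumr exchange_big /= (bigD1 1%g) //= -mulr_suml -rmorph_sum.
  rewrite sum_character // eqxx big1 => [|b /andP[bD b1]].
    by rewrite addr0 mulrA -rmorphM mulVf // rmorph1 mul1r gal_id.
  by rewrite -mulr_suml -rmorph_sum sum_character // (negPf b1) rmorph0 mul0r.
- have bH := inH b bD; have Xb := X_neq0 bH.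
  have sb : b (s j) = c (X b ^+ j) * s j.
    rewrite /s raddf_sum /= [in RHS](reindex_inj (mulIg b)) mulr_sumr /=.
    apply: eq_big => [b'|b' b'D]; first by rewrite groupMr.
    rewrite [LHS]rmorphM /= gal_const // gal_comp mulrA -rmorphM; congr (c _ * _).
    rewrite XM ?(inH b') // exprMn invfM mulrCA mulfV ?expf_neq0 // mulr1 //.
  have bu : b (u ^- j) = (c (X b ^+ j))^-1 * u ^- j.
    by rewrite [LHS]fmorphV /= [X in X^-1]rmorphXn /= hX // exprMn invfM rmorphXn.
  rewrite /z [LHS]rmorphM /= bu [X in X * _]rmorphM /= gal_const // sb.
  have cX : c (X b ^+ j) != 0 by rewrite fmorph_eq0 expf_neq0.
  by rewrite [c (X b ^+ j) * s j]mulrC !mulrA mulfK.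
- rewrite zu vgeMl //; first by rewrite /vge vc lexx orbT.
  by apply: vge_sum => // b bD; rewrite vgeMl ?hy // /vge vc lexx orbT.
Qed.

Lemma kummer_power : u ^+ #|H| \in 1%VS.
Proof.
apply: gal_fixed => // b bH; rewrite [LHS]rmorphXn /= hX // exprMn -rmorphXn X_card //.
by rewrite rmorph1 mul1r.
Qed.

Lemma kummer_poly_surj y : exists P : {poly K}, (map_poly (in_alg L) P).[u] = y.
Proof.
have [z [yE zH _]] := eigen_decomposition y (fintype.subxx _).
have /boolp.choice[f hf] j : exists a : K, z j = a%:A.
  by apply/vlineP; apply: gal_fixed => b; apply: zH.
exists (\poly_(j < #|H|) f j); rewrite yE.
rewrite (@horner_coef_wide _ #|H|) ?size_map_poly ?size_poly //.
by apply: eq_bigr => j _; rewrite coef_map coef_poly ltn_ord hf.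
Qed.

(** A relation between powers of [u] with coefficients in the base is shared by
    the [#|H|] conjugates of [u], too many for a remainder modulo ['X^#|H| - G]. *)
Lemma kummer_poly_ker (G : K) (P : {poly K}) : u ^+ #|H| = G%:A ->
  (map_poly (in_alg L) P).[u] = 0 -> ('X^#|H| - G%:P) %| P.
Proof.
move=> uG Pu; set Q := _ - _; rewrite /dvdp; apply: contraT => R0.
have mQ : Q \is monic by rewrite monicXnsubC.
pose R := map_poly (in_alg L) (P %% Q).
have Qu : (map_poly (in_alg L) Q).[u] = 0.
  by rewrite rmorphB /= map_polyXn map_polyC !hornerE uG subrr.
have Ru : R.[u] = 0.
  have := Pu; rewrite {1}(divp_eq P Q) rmorphD rmorphM hornerD hornerM Qu.
  by rewrite mulr0 add0r.
have rs : all (root R) [seq (b : gal_of {:L}) u | b <- enum H].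
  apply/allP => _ /mapP[b + ->]; rewrite mem_enum => bH.
  have -> : R = map_poly b R.
    apply/polyP => i; rewrite !coef_map /= (fixed_gal _ bH) ?sub1v //.
    by rewrite rpredZ ?mem1v.
  by rewrite /root horner_map Ru rmorph0.
have us : uniq [seq (b : gal_of {:L}) u | b <- enum H].
  rewrite map_inj_in_uniq ?enum_uniq // => b b'; rewrite !mem_enum => bH b'H.
  by rewrite !hX // => /(mulIf u0)/fmorph_inj; apply: Xinj.
have := max_poly_roots _ rs us; rewrite map_poly_eq0 => /(_ R0).
rewrite size_map -cardE size_map_poly => lt.
have := ltn_modpN0 P (monic_neq0 mQ); rewrite size_XnsubC // ltnS => /(leq_trans lt).
by rewrite ltnn.
Qed.

(** * Places of a Kummer extension *)

Variable v : L -> int.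
Hypothesis hv : valuation v.
Hypothesis vc : forall a, v (c a) = 0.
Hypothesis residue_base : forall f, f \in 1%VS -> vge v 0 f -> exists a, vge v 1 (f - c a).

Lemma vge_const a : vge v 0 (c a). Proof. by rewrite /vge vc lexx orbT. Qed.

Lemma vge1_const a : vge v 1 (c a) -> a = 0.
Proof. by rewrite /vge vc fmorph_eq0 /= orbF => /eqP. Qed.

(** The residue field stays equal to [k], being algebraic over it: the minimal
    polynomial of [y], scaled to have integral coefficients that are not all in
    the maximal ideal, reduces to a polynomial over [k], which splits. *)
Lemma residue_exists y : vge v 0 y -> exists a, vge v 1 (y - c a).
Proof.
move=> hy; set P := minPoly 1%AS y.
have P1 i : P`_i \in 1%VS by apply/polyOverP: (minPolyOver 1%AS y) i.
have Py : \sum_(i < size P) P`_i * y ^+ i = 0.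
  by rewrite -horner_coef; apply/rootP; apply: root_minPoly.
have Pl : P`_(size P).-1 != 0.
  by rewrite -/(lead_coef P) lead_coef_eq0 monic_neq0 ?monic_minPoly.
have P0 : (0 < size P)%N by rewrite size_minPoly.
have lt : ((size P).-1 < size P)%N by rewrite prednK.
case: (@arg_minP _ _ _ (Ordinal lt) (fun i => P`_i != 0) (fun i => v P`_i) Pl).
move=> i0 Pi0 imin.
have /boolp.choice[r hr] i : exists a, vge v 1 (P`_i / P`_i0 - c a).
  have [lti|gei] := ltnP i (size P); last first.
    by exists 0; rewrite nth_default // mul0r rmorph0 subrr vge0.
  apply: residue_base; first by rewrite memvM ?memvV.
  have [->|Pi] := eqVneq P`_i 0; first by rewrite mul0r vge0.
  rewrite vgeE ?mulf_neq0 ?invr_neq0 // valM ?invr_neq0 // valV //.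
  by rewrite subr_ge0 (imin (Ordinal lti)).
pose R := \poly_(i < size P) r i.
have R0 : R != 0.
  apply: contraNneq (oner_neq0 k) => R0.
  have r0 : R`_i0 = 0 by rewrite R0 coef0.
  rewrite coef_poly ltn_ord in r0.
  have := hr i0; rewrite r0 rmorph0 subr0 divff // -(rmorph1 c).
  by move=> /vge1_const ->.
have Ry : vge v 1 (map_poly c R).[y].
  rewrite (@horner_coef_wide _ (size P)) ?size_map_poly ?size_poly //.
  have -> : \sum_(i < size P) (map_poly c R)`_i * y ^+ i =
      - \sum_(i < size P) (P`_i / P`_i0 - c (r i)) * y ^+ i.
    apply/eqP; rewrite -addr_eq0 -big_split /=; apply/eqP.
    rewrite -[RHS](_ : (\sum_(i < size P) P`_i * y ^+ i) / P`_i0 = 0); last by rewrite Py mul0r.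
    rewrite mulr_suml; apply: eq_bigr => i _.
    by rewrite coef_map coef_poly ltn_ord -mulrDl addrC subrK mulrAC.
  rewrite vgeN //; apply: vge_sum => // i _.
  rewrite -[1]addr0 vgeM ?hr //.
  elim: (i : nat) => [|j IH]; first by rewrite expr0 -(rmorph1 c) vge_const.
  by rewrite exprS vgeMl.
have [rs hrs] := closed_field_poly_normal R.
apply: contrapT => nores; have := Ry; rewrite hrs map_polyZ hornerZ /=.
rewrite rmorph_prod horner_prod.
have lR : lead_coef R != 0 by rewrite lead_coef_eq0.
have [pr0 vpr] : \prod_(a <- rs) (map_poly c ('X - a%:P)).[y] != 0 /\
    v (\prod_(a <- rs) (map_poly c ('X - a%:P)).[y]) = 0.
  apply: val_prod0 => // a _; rewrite rmorphB /= map_polyX map_polyC !hornerE.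
  have ya : ~~ vge v 1 (y - c a) by apply: contra_notN nores => ya; exists a.
  have : vge v 0 (y - c a) by rewrite vgeB ?vge_const.
  move: ya; rewrite /vge negb_or -ltNge => /andP[nz lt1]; rewrite (negPf nz) /= => ge0.
  by split=> //; apply/eqP; rewrite eq_le ge0 andbT -ltzD1 add0r.
rewrite vgeE ?mulf_neq0 ?fmorph_eq0 // valM ?fmorph_eq0 // vc vpr.
by rewrite addr0.
Qed.

Variables (t : L) (e : nat).
Hypothesis t1 : t \in 1%VS.
Hypothesis e_gt0 : (0 < e)%N.
Hypothesis vt : v t = e%:Z.
Hypothesis v_base : forall f, f \in 1%VS -> f != 0 -> (e%:Z %| v f)%Z.

Lemma t_neq0 : t != 0.
Proof.
apply: contraTneq e_gt0 => t0; move: vt; rewrite t0; case: hv => _ _ -> [<-].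
by [].
Qed.

(** The order of [v u] in the integers modulo [e]; it equals [e] when [v] is
    normalized ([order_mod_eq]). *)
Definition order_mod : nat := e %/ gcdn e `|v u|.
Definition unit_part : L := u ^+ order_mod * t ^ (- (v u %/ (gcdn e `|v u|)%:Z)%Z).
Local Notation q := order_mod.
Local Notation w := unit_part.
Local Notation D := (X_torsion q).

Lemma q_gt0 : (0 < q)%N.
Proof. by rewrite divn_gt0 ?gcdn_gt0 ?e_gt0 // dvdn_leq // dvdn_gcdl. Qed.

Lemma gal_t b : b \in H -> b t = t.
Proof. by move=> bH; apply: (fixed_gal _ bH); rewrite ?sub1v. Qed.

Lemma gal_uX b n : b \in H -> b (u ^+ n) = c (X b ^+ n) * u ^+ n.
Proof. by move=> bH; rewrite [LHS]rmorphXn /= hX // exprMn -rmorphXn. Qed.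

Lemma gal_tX b (n : int) : b \in H -> b (t ^ n) = t ^ n.
Proof. by move=> bH; rewrite [LHS]fmorphXz /= gal_t. Qed.

Lemma gal_w b : b \in H -> b w = c (X b ^+ q) * w.
Proof.
by move=> bH; rewrite [LHS]rmorphM /= gal_uX // gal_tX // mulrA.
Qed.

Lemma w_neq0 : w != 0.
Proof. by rewrite mulf_neq0 ?expf_neq0 // expfz_neq0 // t_neq0. Qed.

Lemma val_w : v w = 0.
Proof.
have g0 : (0 < gcdn e `|v u|)%N by rewrite gcdn_gt0 e_gt0.
rewrite valM ?expf_neq0 ?expfz_neq0 ?t_neq0 // valX // valXz ?t_neq0 // vt.
have /divnK := dvdn_gcdl e `|v u|; rewrite -/q => he.
have /divzK : ((gcdn e `|v u|)%:Z %| v u)%Z by rewrite dvdzE dvdn_gcdr.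
set g' := (v u %/ _)%Z => hu; rewrite -{1}hu -{2}he PoszM; lia.
Qed.

Lemma q_dvd_mul n : (e%:Z %| n * v u)%Z -> (q %| `|n|)%N.
Proof.
rewrite dvdzE abszM /= => h; have g0 : (0 < gcdn e `|v u|)%N by rewrite gcdn_gt0 e_gt0.
have cop : coprime q (`|v u| %/ gcdn e `|v u|).
  by rewrite /coprime -(eqn_pmul2r g0) mul1n muln_gcdl !divnK ?dvdn_gcdl ?dvdn_gcdr.
rewrite -(Gauss_dvdl _ cop) -(dvdn_pmul2r g0) -mulnA !divnK ?dvdn_gcdl ?dvdn_gcdr //.
Qed.

Lemma q_dvd_card : (q %| #|H|)%N.
Proof.
apply: (@q_dvd_mul #|H|%:Z); rewrite -valX //.
by apply: v_base; rewrite ?kummer_power ?expf_neq0.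
Qed.

Lemma card_D : #|D| = q.
Proof. by rewrite card_X_torsion ?q_gt0 ?q_dvd_card. Qed.

Lemma D_sub : D \subset H. Proof. exact: X_torsion_sub. Qed.

Lemma w_residue : exists a, vge v 1 (w - c a).
Proof. by apply: residue_exists; rewrite /vge val_w lexx orbT. Qed.

(** If [a] is the residue of [w] at [v], its residue at the conjugate of [v] under
    [b] is [X b ^+ q * a], which differs from [a] unless [b] lies in [D]; a product
    of linear factors in [w] separates [v] from these conjugates. *)
Lemma separating_function : exists h : L,
  [/\ h != 0, v h = 0, forall b, b \in D -> b h = h,
      forall b, b \in H -> b \notin D -> vge v 1 (b h) &
      exists rs : seq k, h = \prod_(r <- rs) (w - c r)].
Proof.
have [a ha] := w_residue.
have a0 : a != 0.
  apply: contraTneq ha => ->; rewrite rmorph0 subr0 vgeE ?w_neq0 // val_w.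
  by [].
pose F b := w - c (X b ^+ q * a).
have Fb b' b : b' \in H -> b' (F b) = c (X b' ^+ q) * w - c (X b ^+ q * a).
  by move=> b'H; rewrite [LHS]rmorphB /= gal_w // gal_const.
have w_ge0 : vge v 0 w by rewrite /vge val_w lexx orbT.
exists (\prod_(b in H :\: D) F b).
have [h0 vh] : \prod_(b in H :\: D) F b != 0 /\ v (\prod_(b in H :\: D) F b) = 0.
  apply: val_prod0 => // b; rewrite !inE negb_and => /andP[+ bH]; rewrite bH /= => nbD.
  have -> : F b = c (a - X b ^+ q * a) + (w - c a) by rewrite /F rmorphB; ring.
  have nz : c (a - X b ^+ q * a) != 0.
    by rewrite fmorph_eq0 -[X in X - _]mul1r -mulrBl mulf_neq0 // subr_eq0 eq_sym.
  rewrite -(vc (a - X b ^+ q * a)); apply: valD_dominant => //.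
  by rewrite vc add0r.
split=> // [b bD|b bH nbD|].
- have bH := fintype.subsetP D_sub b bD.
  rewrite rmorph_prod /=; apply: eq_bigr => b' _.
  have /eqP Xb : X b ^+ q == 1 by move: bD; rewrite inE => /andP[].
  by rewrite Fb // Xb rmorph1 mul1r.
- rewrite rmorph_prod /= (bigD1 b) /=; last by rewrite inE nbD.
  rewrite -[1]addr0 vgeM //.
    by rewrite Fb // rmorphM -mulrBr vgeMl ?vge_const.
  apply: vge_prod => // b' _; rewrite Fb //.
  by rewrite vgeB ?vge_const // vgeMl ?vge_const.
- exists [seq X b ^+ q * a | b <- enum (H :\: D)].
  by rewrite big_map big_enum.
Qed.

Lemma separating_power h : (forall b, b \in H -> b \notin D -> vge v 1 (b h)) ->
  forall y n, exists M, forall b, b \in H -> b \notin D -> vge v n (b (h ^+ M * y)).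
Proof.
move=> hh y n; pose M := (\sum_(b : gal_of {:L}) `|n - v (b y)|)%N; exists M => b bH nbD.
have le : (`|n - v (b y)| <= M)%N by rewrite /M (bigD1 b) //= leq_addr.
have hM : vge v M%:Z (b h ^+ M).
  elim: M {le} => [|M IH]; first by rewrite expr0 -(rmorph1 c) vge_const.
  by rewrite exprS intS vgeM // hh.
rewrite rmorphM rmorphXn; apply: vge_le (vgeM hv hM (vge_val v (b y))).
by lia.
Qed.

(** Multiplied by a power of the separating function, [y] keeps its order at [v] and
    becomes small at the conjugates of [v] under automorphisms outside [D]; it then
    has the same order as its trace, which lies in the base field. *)
Lemma val_D_fixed y : y != 0 -> (forall b, b \in D -> b y = y) -> (e%:Z %| v y)%Z.
Proof.
move=> y0 Dy; have [h [h0 vh hD hnD _]] := separating_function.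
have [M hM] := separating_power hnD y (v y + 1).
set z := h ^+ M * y in hM.
have z0 : z != 0 by rewrite mulf_neq0 ?expf_neq0.
have vz : v z = v y by rewrite valM ?expf_neq0 // valX // vh mulr0 add0r.
have Dz b : b \in D -> b z = z.
  by move=> bD; rewrite rmorphM rmorphXn /= hD // Dy.
pose T := \sum_(b in H) b z.
have TE : T = c #|D|%:R * z + \sum_(b in H :\: D) b z.
  rewrite /T (big_setID D) /= (finset.setIidPr D_sub); congr (_ + _).
  rewrite (eq_bigr (fun=> z)) => [|b bD]; last by rewrite Dz.
  by rewrite sumr_const rmorph_nat mulr_natl.
have D0 : c #|D|%:R != 0 by rewrite fmorph_eq0 card_neq0 // D_sub.
have vDz : v (c #|D|%:R * z) = v y by rewrite valM // vc vz add0r.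
have [T0 vT] : T != 0 /\ v T = v y.
  rewrite TE -vDz; apply: valD_dominant => //; first by rewrite mulf_neq0.
  rewrite vDz; apply: vge_sum => // b; rewrite inE => /andP[nbD bH].
  exact: hM.
rewrite -vT; apply: v_base => //; apply: gal_fixed => // b bH.
rewrite rmorph_sum /= [RHS](reindex_inj (mulIg b)) /=.
by apply: eq_big => [b'|b' b'H]; rewrite ?groupMr // gal_comp.
Qed.

(** The [D]-eigencomponents of a function have orders in distinct classes modulo
    [e], so the smallest of them is the order of the function. *)
Lemma val_D_eigen y : y != 0 ->
  (forall b, b \in D -> v y <= v (b y)) /\ exists n, (e%:Z %| v y - n * v u)%Z.
Proof.
move=> y0; have [z [yE zD _]] := eigen_decomposition y D_sub.
have vzu (j : nat) : z j != 0 -> v (z j * u ^+ j) = v (z j) + j%:Z * v u.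
  by move=> zj; rewrite valM ?expf_neq0 // valX.
have [i] : exists i : 'I_#|D|, [/\ z i * u ^+ i != 0,
    v (\sum_(j < #|D|) z j * u ^+ j) = v (z i * u ^+ i) &
    forall j : 'I_#|D|, vge v (v (z i * u ^+ i)) (z j * u ^+ j)].
  apply: (val_sum_distinct hv (F := fun j : 'I_#|D| => z j * u ^+ j)); rewrite -?yE // => i j.
  rewrite !mulf_eq0 !negb_or => /andP[zi _] /andP[zj _].
  rewrite !vzu // => eq_v; apply: val_inj.
  have hi := val_D_fixed zi (zD i); have hj := val_D_fixed zj (zD j).
  have /q_dvd_mul : (e%:Z %| ((i : nat)%:Z - (j : nat)%:Z) * v u)%Z.
    have -> : ((i : nat)%:Z - (j : nat)%:Z) * v u = v (z j) - v (z i).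
      by move: eq_v; clear; lia.
    by rewrite rpredB.
  by apply: eq_of_dvd_dist; apply: leq_trans (ltn_ord _) (eq_leq card_D).
rewrite -yE mulf_eq0 negb_or => -[/andP[zi _] vy hmin]; split; last first.
  exists (i : nat)%:Z; rewrite vy vzu // addrK; exact: val_D_fixed (zD i).
move=> b bD; have bH := fintype.subsetP D_sub b bD.
have by0 : b y != 0 by rewrite fmorph_eq0.
rewrite -vgeE // {2}yE rmorph_sum /=; apply: vge_sum => // j _.
have -> : b (z j * u ^+ j) = c (X b ^+ j) * (z j * u ^+ j).
  by rewrite [LHS]rmorphM /= zD // gal_uX // mulrCA.
by rewrite vgeMl ?vge_const // vy.
Qed.

Lemma val_D_stable y b : b \in D -> v (b y) = v y.
Proof.
move=> bD; have [->|y0] := eqVneq y 0; first by rewrite rmorph0.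
have by0 : b y != 0 by rewrite fmorph_eq0.
apply/eqP; rewrite eq_le (val_D_eigen y0).1 // andbT.
have := (val_D_eigen by0).1 b^-1%g; rewrite -gal_comp mulgV gal_id; apply.
by rewrite groupV.
Qed.

Lemma stabilizer_D b : b \in H -> (forall y, v (b y) = v y) -> b \in D.
Proof.
move=> bH hb; rewrite inE bH /=; have [a ha] := w_residue.
have a0 : a != 0.
  apply: contraTneq ha => ->; rewrite rmorph0 subr0 vgeE ?w_neq0 // val_w.
  by [].
have hba : vge v 1 (b (w - c a)) by move: ha; rewrite /vge fmorph_eq0 hb.
have : vge v 1 (c (X b ^+ q * a - a)).
  have -> : c (X b ^+ q * a - a) = b (w - c a) - c (X b ^+ q) * (w - c a).
    by rewrite [b _]rmorphB /= gal_w // gal_const // rmorphB rmorphM; ring.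
  by rewrite vgeB // vgeMl ?vge_const.
move/vge1_const/eqP; rewrite subr_eq0 -[X in _ == X]mul1r.
by rewrite (inj_eq (mulIf a0)).
Qed.

Hypothesis v_surj : exists s, v s = 1.

Lemma order_mod_eq : q = e.
Proof.
have [s vs] := v_surj.
have s0 : s != 0 by apply/eqP => s0; move: vs; rewrite s0; case: hv => _ _ ->.
have [_ [n]] := val_D_eigen s0; rewrite vs => /dvdzP[m hm'].
suff : gcdn e `|v u| = 1%N by rewrite /order_mod => ->; rewrite divn1.
apply/eqP; rewrite -dvdn1 -[1%N]/(`|1%:Z|)%N.
have -> : 1%:Z = m * e%:Z + n * v u by rewrite -hm' subrK.
rewrite -[X in (X %| _)%N]/(`|(gcdn e `|v u|)%:Z|)%N -dvdzE.
by rewrite rpredD // dvdz_mull // dvdzE /= ?dvdn_gcdl ?dvdn_gcdr.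
Qed.

Lemma card_stabilizer (A : {set gal_of {:L}}) :
  (forall b, b \in A <-> b \in H /\ forall y, v (b y) = v y) -> #|A| = e.
Proof.
move=> hA; rewrite -[RHS]order_mod_eq -card_D; apply: eq_card => b; apply/idP/idP.
  by case/hA => bH hb; apply: stabilizer_D.
move=> bD; apply/hA; split; first exact: (fintype.subsetP D_sub).
by move=> y; apply: val_D_stable.
Qed.

(** * The logarithmic derivation at a place *)

Variable th : L -> L.
Hypothesis thD : forall f g, th (f + g) = th f + th g.
Hypothesis thM : forall f g, th (f * g) = f * th g + g * th f.
Hypothesis thc : forall a, th (c a) = 0.
Hypothesis th_t : th t = t.
Hypothesis th_base : forall f, f \in 1%VS -> vge v (v f) (th f).

Definition dlog f := th f / f.

Lemma th_dlog f : f != 0 -> th f = f * dlog f.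
Proof. by move=> f0; rewrite /dlog mulrC divfK. Qed.

Lemma dlogM f g : f != 0 -> g != 0 -> dlog (f * g) = dlog f + dlog g.
Proof. by move=> f0 g0; rewrite /dlog thM; field; rewrite f0 g0. Qed.

Lemma dlog1 : dlog 1 = 0.
Proof. by rewrite /dlog -(rmorph1 c) thc mul0r. Qed.

Lemma dlogX f n : f != 0 -> dlog (f ^+ n) = dlog f *+ n.
Proof.
move=> f0; elim: n => [|n IH]; first by rewrite expr0 dlog1.
by rewrite exprS dlogM ?expf_neq0 // IH mulrS.
Qed.

Lemma dlogV f : f != 0 -> dlog f^-1 = - dlog f.
Proof.
move=> f0; apply: (@addrI _ (dlog f)).
by rewrite -dlogM ?invr_neq0 // divff // dlog1 subrr.
Qed.

Lemma dlogXz f (n : int) : f != 0 -> dlog (f ^ n) = dlog f *~ n.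
Proof.
move=> f0; case: n => n; first by rewrite -exprnP dlogX.
by rewrite NegzE -exprnN dlogV ?expf_neq0 // dlogX // mulrNz.
Qed.

Lemma vgeMn n f m : vge v n f -> vge v n (f *+ m).
Proof. by move=> nf; rewrite -mulr_natl -(rmorph_nat c) vgeMl ?vge_const. Qed.

Lemma vgeMz n f (m : int) : vge v n f -> vge v n (f *~ m).
Proof.
case: m => m nf; first by rewrite -pmulrn vgeMn.
by rewrite NegzE mulrNz -pmulrn vgeN // vgeMn.
Qed.

Lemma th0 : th 0 = 0. Proof. by rewrite -(rmorph0 c) thc rmorph0. Qed.

Lemma th_sum I (r : seq I) (P : pred I) (F : I -> L) :
  th (\sum_(i <- r | P i) F i) = \sum_(i <- r | P i) th (F i).
Proof. exact: (big_morph _ thD th0). Qed.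

Lemma dlog_t : dlog t = 1.
Proof. by rewrite /dlog th_t divff // t_neq0. Qed.

Lemma vge_dlog f n : f != 0 -> vge v n (dlog f) = vge v (v f + n) (th f).
Proof.
move=> f0; rewrite (th_dlog f0) /vge [f * _ == 0]mulf_eq0 (negPf f0) /=.
by case: eqVneq => //= d0; rewrite [v (f * _)]valM // lerD2l.
Qed.

Lemma dlog_base f : f \in 1%VS -> vge v 0 (dlog f).
Proof.
move=> f1; have [->|f0] := eqVneq f 0; first by rewrite /dlog th0 mul0r vge0.
by rewrite vge_dlog // addr0 th_base.
Qed.

Lemma dlog_u : vge v 0 (dlog u).
Proof.
have -> : dlog u = c (#|H|%:R^-1) * dlog (u ^+ #|H|).
  rewrite (dlogX #|H| u0) -[dlog u *+ _]mulr_natl mulrA -(rmorph_nat c) -rmorphM mulVf //.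
  by rewrite rmorph1 mul1r.
by rewrite vgeMl ?vge_const // dlog_base // kummer_power.
Qed.

Lemma dlog_w : vge v 0 (dlog w).
Proof.
rewrite dlogM ?expf_neq0 ?expfz_neq0 ?t_neq0 // dlogX // dlogXz ?t_neq0 // dlog_t.
by rewrite vgeD ?vgeMn ?dlog_u // vgeMz // -(rmorph1 c) vge_const.
Qed.

(** Multiplying [y] by a large power of the separating function makes all its
    conjugates integral, so that each Kummer component [z j * u ^+ j] of the
    result is integral; for such terms the claim is a computation. *)
Lemma th_integral y : vge v 0 y -> vge v 0 (th y).
Proof.
move=> y_ge0; have [->|y0] := eqVneq y 0; first by rewrite th0 vge0.
have [h [h0 vh _ hnD [rs hrs]]] := separating_function.
have [M hM] := separating_power hnD y 0.
have hM0 : h ^+ M != 0 by rewrite expf_neq0.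
have vhM : v (h ^+ M) = 0 by rewrite valX // vh mulr0.
set z := h ^+ M * y in hM.
have z0 : z != 0 by rewrite mulf_neq0.
have z_ge0 b : b \in H -> vge v 0 (b z).
  move=> bH; have [bD|] := boolP (b \in D); last exact: hM.
  rewrite /vge fmorph_eq0 val_D_stable // (negPf z0) /=.
  by rewrite /z valM // vhM add0r -vgeE.
have [s [zE sH /(_ v 0 hv vc z_ge0) s_ge0]] := eigen_decomposition z (fintype.subxx _).
have thz : vge v 0 (th z).
  rewrite zE th_sum; apply: vge_sum => // j _.
  have [->|sj] := eqVneq (s j) 0; first by rewrite mul0r th0 vge0.
  rewrite th_dlog ?mulf_neq0 ?expf_neq0 // vgeMl // dlogM ?expf_neq0 //.
  by rewrite vgeD ?dlogX ?vgeMn ?dlog_u // dlog_base // gal_fixed // => b /sH.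
have thh : vge v 0 h /\ vge v 0 (th h).
  rewrite hrs; apply: (big_ind (fun f => vge v 0 f /\ vge v 0 (th f))).
  - by rewrite -(rmorph1 c) thc vge_const vge0.
  - by move=> f g [f1 f2] [g1 g2]; rewrite thM; split; rewrite ?vgeD ?vgeMl.
  move=> r _; split; first by rewrite vgeB ?vge_const // /vge val_w lexx orbT.
  rewrite -rmorphN thD thc addr0 -[0](addr0 0) -{1}val_w -vge_dlog ?w_neq0 //.
  exact: dlog_w.
have dlogh : vge v 0 (dlog h) by rewrite vge_dlog // vh thh.2.
have -> : th y = h ^- M * th z - y * (dlog h *+ M).
  rewrite (th_dlog z0) (th_dlog y0) /z dlogM // dlogX //.
  by rewrite -mulr_natl; field.
have hV : vge v 0 (h ^- M) by rewrite /vge valV // vhM oppr0 lexx orbT.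
by rewrite vgeB // vgeMl // vgeMn.
Qed.

Lemma dlog_integral f : f != 0 -> vge v 0 (dlog f).
Proof.
move=> f0; have unitP g : g != 0 -> v g = 0 -> vge v 0 (dlog g).
  by move=> g0 vg; rewrite vge_dlog // vg addr0 th_integral // /vge vg lexx orbT.
have cop : coprimez e%:Z (v u).
  have /eqP : (e * gcdn e `|v u| = e * 1)%N.
    by rewrite muln1 -{1}order_mod_eq /order_mod divnK ?dvdn_gcdl.
  by rewrite eqn_pmul2l // => /eqP eg1; rewrite /coprimez /gcdz /= eg1.
have /coprimezP[[a b] /= ab] := cop.
pose pi := t ^ a * u ^ b.
have ta : t ^ a != 0 by rewrite expfz_neq0 ?t_neq0.
have ub : u ^ b != 0 by rewrite expfz_neq0.
have pi0 : pi != 0 by rewrite mulf_neq0.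
have vpi : v pi = 1 by rewrite valM // !valXz ?t_neq0 // vt.
have dpi : vge v 0 (dlog pi).
  rewrite dlogM // !dlogXz ?t_neq0 // dlog_t vgeD ?vgeMz ?dlog_u //.
  by rewrite -(rmorph1 c) vge_const.
pose n := v f; have pn : pi ^ n != 0 by rewrite expfz_neq0.
have g0 : f / pi ^ n != 0 by rewrite mulf_neq0 ?invr_neq0.
have -> : f = pi ^ n * (f / pi ^ n) by rewrite mulrC divfK.
rewrite dlogM // dlogXz // vgeD ?vgeMz // unitP // valM ?invr_neq0 // valV //.
by rewrite valXz // vpi mulr1 subrr.
Qed.

Lemma th_maximal y : vge v 0 y -> vge v 1 (th y).
Proof.
move=> /residue_exists[a ha]; rewrite -[y](subrK (c a)) thD thc addr0.
have [->|y0] := eqVneq (y - c a) 0; first by rewrite th0 vge0.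
by rewrite th_dlog // -[1]addr0 vgeM // dlog_integral.
Qed.

(** Tameness: [t] is a unit times the [e]-th power of [s], and [e] is invertible. *)
Lemma val_th_uniformizer s : v s = 1 -> th s != 0 /\ v (th s) = 1.
Proof.
move=> vs; have s0 : s != 0.
  by apply/eqP => s0; move: vs; rewrite s0; case: hv => _ _ ->.
have se : s ^+ e != 0 by rewrite expf_neq0.
pose eta := t / s ^+ e.
have eta0 : eta != 0 by rewrite mulf_neq0 ?invr_neq0 ?t_neq0.
have veta : v eta = 0.
  by rewrite valM ?invr_neq0 ?t_neq0 // valV // valX // vt vs mulr1 subrr.
have deta : vge v 1 (dlog eta).
  by rewrite vge_dlog // veta add0r th_maximal // /vge veta lexx orbT.
have E : dlog s *+ e = 1 - dlog eta.
  rewrite -dlog_t -[t in RHS](divfK se) -/eta dlogM // dlogX //; ring.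
have [n0 vn] : 1 - dlog eta != 0 /\ v (1 - dlog eta) = v 1.
  by apply: valD_dominant => //; rewrite ?oner_neq0 // val1 // add0r vgeN.
have e0 : c e%:R != 0.
  by rewrite fmorph_eq0 -order_mod_eq -card_D card_neq0 // D_sub.
have ds : dlog s != 0 by apply: contra_neq n0; rewrite -E => ->; rewrite mul0rn.
rewrite (th_dlog s0) mulf_neq0 //; split=> //; rewrite valM // vs.
have -> : v (dlog s) = v (dlog s *+ e).
  by rewrite -[dlog s *+ _]mulr_natl -(rmorph_nat c) [RHS]valM // vc add0r.
by rewrite E vn val1 // addr0.
Qed.

End Kummer.

(** * Fraction fields *)

Section FractionField.

Variables (R : idomainType) (F : fieldType).

Lemma fraction_quotient (f : {fraction R}) :
  exists2 P : R * R, P.2 != 0 & f = tofrac P.1 / tofrac P.2.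
Proof.
elim/generic_quotient.quotW: f => x; have d0 : \d_x != 0 by apply: denom_ratioP.
exists (\n_x, \d_x) => //=; rewrite -[_ / _]/(FracField.mul _ (FracField.inv _)) !piE.
apply/generic_quotient.eqmodP; rewrite /= FracField.equivfE /FracField.invf /FracField.mulf.
by rewrite !numden_Ratio ?mulf_neq0 ?oner_neq0 // mulr1 mul1r mulrC.
Qed.

(** The universal property of the field of fractions. *)
Lemma fraction_lift (g : {rmorphism R -> F}) : injective g ->
  exists phi : {rmorphism {fraction R} -> F}, forall r, phi (tofrac r) = g r.
Proof.
move=> ginj.
have g0 r : r != 0 -> g r != 0 by apply: contra_neq; rewrite -[in X in X -> _](rmorph0 g); apply: ginj.
have /boolp.choice[num hnum] f : exists P : R * R, P.2 != 0 /\ f = tofrac P.1 / tofrac P.2.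
  by have [P P2 fE] := fraction_quotient f; exists P.
pose phi f := g (num f).1 / g (num f).2.
have phiE P Q : Q != 0 -> phi (tofrac P / tofrac Q) = g P / g Q.
  move=> Q0; rewrite /phi; have := hnum (tofrac P / tofrac Q).
  case: (num _) => n d /= [d0 /eqP]; rewrite eqr_div ?tofrac_eq0 // -!tofracM tofrac_eq.
  by move=> /eqP nd; apply/eqP; rewrite eqr_div ?g0 // -!rmorphM -nd.
have phiB : zmod_morphism phi.
  move=> f1 f2; have [[a b] /= b0 ->] := fraction_quotient f1.
  have [[a' b'] /= b0' ->] := fraction_quotient f2.
  rewrite -mulNr addf_div ?tofrac_eq0 // -tofracN -!tofracM -tofracD.
  rewrite !phiE ?mulf_neq0 // rmorphD !rmorphM rmorphN.
  by field; rewrite !g0.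
have phiM : monoid_morphism phi.
  split; first by rewrite -[1]divr1 -tofrac1 phiE ?oner_neq0 // rmorph1 divr1.
  move=> f1 f2; have [[a b] /= b0 ->] := fraction_quotient f1.
  have [[a' b'] /= b0' ->] := fraction_quotient f2.
  rewrite mulf_div -!tofracM !phiE ?mulf_neq0 // !rmorphM.
  by field; rewrite !g0.
pose phi' : {rmorphism {fraction R} -> F} := HB.pack phi
  (GRing.isZmodMorphism.Build _ _ phi phiB) (GRing.isMonoidMorphism.Build _ _ phi phiM).
exists phi' => r; rewrite -[tofrac r]divr1 -tofrac1 /= phiE ?oner_neq0 //.
by rewrite rmorph1 divr1.
Qed.

End FractionField.

(** * The valuations of the rational function field *)

Lemma inv_addE (F : fieldType) (a g : F) : a != 0 -> a + g != 0 ->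
  (a + g)^-1 = a^-1 + - (a^-1 * (a + g)^-1 * g).
Proof. by move=> a0 s0; field; rewrite a0 s0. Qed.

Lemma expansionM (F : fieldType) (t a b f g : F) (n m : int) : t != 0 ->
  t ^ n * (a + f) * (t ^ m * (b + g)) = t ^ (n + m) * (a * b + (a * g + f * (b + g))).
Proof. by move=> t0; rewrite expfzDr //; ring. Qed.

Section Line.

Variable k : closedFieldType.

Local Notation K := {fraction {poly k}}.
Local Notation cK := (@tofrac {poly k} \o polyC).
Local Notation T := (tofrac ('X : {poly k})).

Definition param (x : option k) : K := if x is Some a then T - cK a else T^-1.

Lemma cK_neq0 a : (cK a != 0) = (a != 0).
Proof. by rewrite /= tofrac_eq0 polyC_eq0. Qed.

Lemma TsubE b : T - cK b = tofrac ('X - b%:P).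
Proof. by rewrite tofracB. Qed.

Lemma Tsub_neq0 b : T - cK b != 0.
Proof. by rewrite TsubE tofrac_eq0 polyXsubC_eq0. Qed.

Lemma T_neq0 : T != 0. Proof. by rewrite tofrac_eq0 polyX_eq0. Qed.

Lemma param_neq0 x : param x != 0.
Proof. by case: x => [a|]; rewrite ?Tsub_neq0 // invr_neq0 // T_neq0. Qed.

Lemma ratfun_quotient (f : K) : f != 0 ->
  exists p q : {poly k}, [/\ p != 0, q != 0 & f = tofrac p / tofrac q].
Proof.
have [[p q] /= q0 ->] := fraction_quotient f.
have [->|p0 _] := eqVneq p 0; first by rewrite tofrac0 mul0r eqxx.
by exists p, q.
Qed.

(** As [k] is algebraically closed, the multiplicative group of [k(t)] is
    generated by the constants and the linear polynomials. *)
Lemma ratfun_ind (P : K -> Prop) :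
  (forall a, a != 0 -> P (cK a)) -> (forall b, P (T - cK b)) ->
  (forall f g, f != 0 -> g != 0 -> P f -> P g -> P (f * g)) ->
  (forall f, f != 0 -> P f -> P f^-1) ->
  forall f, f != 0 -> P f.
Proof.
move=> Pc Pl PM PV.
have Pp p : p != 0 -> P (tofrac p).
  move=> p0; have [rs ->] := closed_field_poly_normal p.
  rewrite -mul_polyC tofracM; have l0 : lead_coef p != 0 by rewrite lead_coef_eq0.
  apply: (PM); rewrite ?tofrac_eq0 ?polyC_eq0 ?monic_neq0 ?monic_prod_XsubC //; first exact: Pc.
  elim: rs => [|b rs IH]; first by rewrite big_nil; apply: (Pc 1); apply: oner_neq0.
  rewrite big_cons tofracM -TsubE; apply: (PM) => //; first exact: Tsub_neq0.
  by rewrite tofrac_eq0 monic_neq0 ?monic_prod_XsubC.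
move=> f /ratfun_quotient[p [q [p0 q0 ->]]].
apply: (PM); rewrite ?invr_eq0 ?tofrac_eq0 //; first exact: Pp.
by apply: (PV); rewrite ?tofrac_eq0 //; apply: Pp.
Qed.

Definition pord (x : option k) (p : {poly k}) : int :=
  if x is Some a then (mup a p)%:Z else - ((size p).-1)%:Z.

Definition ordK (x : option k) (f : K) : int :=
  xget 0 [set n | exists p q, [/\ p != 0, q != 0, f = tofrac p / tofrac q
                                & n = pord x p - pord x q]].

Lemma pordM x p q : p != 0 -> q != 0 -> pord x (p * q) = pord x p + pord x q.
Proof.
move=> p0 q0; case: x => [a|] /=; first by rewrite mupM.
rewrite size_mul //; move: p0 q0; rewrite -!size_poly_gt0.
by move: (size p) (size q) => m n; clear; lia.
Qed.

Lemma pordD x p q : p != 0 -> q != 0 -> p + q != 0 ->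
  Num.min (pord x p) (pord x q) <= pord x (p + q).
Proof.
move=> p0 q0 s0; rewrite ge_min; case: x => [a|] /=.
  rewrite !lez_nat; have [le|lt] := leqP (mup a p) (mup a q).
    by rewrite (mup_geq a _ s0) dvdp_add // -?mup_geq ?leqnn.
  by rewrite orbC (mup_geq a _ s0) dvdp_add // -?mup_geq ?leqnn // ltnW.
rewrite !lerN2 !lez_nat; have := size_polyD p q.
by move: (size p) (size q) (size (p + q)) => m n l; rewrite leq_max; clear; lia.
Qed.

Lemma ordKE x p q : p != 0 -> q != 0 ->
  ordK x (tofrac p / tofrac q) = pord x p - pord x q.
Proof.
move=> p0 q0; apply: xget_unique; first by exists p, q.
move=> n [p' [q' [p0' q0' + ->]]] => /eqP.
rewrite eqr_div ?tofrac_eq0 // -!tofracM tofrac_eq => /eqP/(congr1 (pord x)).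
by rewrite !pordM //; lia.
Qed.

Lemma ordK0 x : ordK x 0 = 0.
Proof.
apply: xgetPN => n [p [q [p0 q0 /eqP + _]]].
by rewrite eq_sym mulf_eq0 invr_eq0 !tofrac_eq0 (negPf p0) (negPf q0).
Qed.

Lemma valuation_ordK x : valuation (ordK x).
Proof.
split=> [f g|f g|]; last exact: ordK0.
  move=> /ratfun_quotient[p [q [p0 q0 ->]]] /ratfun_quotient[p' [q' [p0' q0' ->]]].
  have -> : tofrac p / tofrac q * (tofrac p' / tofrac q') = tofrac (p * p') / tofrac (q * q').
    by rewrite mulf_div -!tofracM.
  by rewrite !ordKE ?mulf_neq0 // !pordM //; lia.
move=> /ratfun_quotient[p [q [p0 q0 ->]]] /ratfun_quotient[p' [q' [p0' q0' ->]]].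
have -> : tofrac p / tofrac q + tofrac p' / tofrac q'
    = tofrac (p * q' + p' * q) / tofrac (q * q').
  by rewrite addf_div ?tofrac_eq0 // -!tofracM -tofracD.
have [->|s0 _] := eqVneq (p * q' + p' * q) 0; first by rewrite tofrac0 mul0r eqxx.
rewrite !ordKE ?mulf_neq0 // pordM //.
have := pordD x (mulf_neq0 p0 q0') (mulf_neq0 p0' q0) s0.
rewrite (pordM x p0 q0') (pordM x p0' q0) !ge_min; move: (pord x (_ + _)).
by move: (pord x p) (pord x q) (pord x p') (pord x q'); clear; lia.
Qed.

Lemma ordK_const x a : ordK x (cK a) = 0.
Proof.
have [->|a0] := eqVneq a 0; first by rewrite rmorph0 ordK0.
rewrite -[cK a]divr1 -[1]tofrac1 ordKE ?polyC_eq0 ?oner_neq0 //.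
case: x => [b|] /=; last by rewrite size_polyC a0 size_poly1.
by rewrite -polyC1 !mupNroot // rootC ?oner_neq0.
Qed.

Lemma ordK_param x : ordK x (param x) = 1.
Proof.
case: x => [a|] /=.
  rewrite TsubE -[tofrac _]divr1 -[1 in LHS]tofrac1 ordKE ?polyXsubC_eq0 ?oner_neq0 //=.
  rewrite -polyC1 [mup _ 1%:P]mupNroot ?rootC ?oner_neq0 //.
  by rewrite -['X - _]expr1 mup_XsubCX eqxx.
by rewrite -[T^-1]mul1r -tofrac1 ordKE ?polyX_eq0 ?oner_neq0 //= size_poly1 size_polyX.
Qed.

Section AboveAPoint.

Variables (x : option k) (v : K -> int) (e : nat).
Hypothesis hv : valuation v.
Hypothesis vc : forall a, v (cK a) = 0.
Hypothesis e_gt0 : (0 < e)%N.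
Hypothesis v_param : v (param x) = e%:Z.

Lemma val_linear b :
  v (T - cK b) = if x is Some a then (if a == b then e%:Z else 0) else - e%:Z.
Proof.
case: x v_param => [a|] vx; last first.
  have vT : v T = - e%:Z by rewrite -vx /= valV // opprK.
  rewrite (valD_dominant hv T_neq0 _).2 // vT.
  by rewrite /vge valN // vc oppr_eq0 /=; apply/orP; right; lia.
case: eqP => [<-|/eqP ab]; first exact: vx.
have -> : T - cK b = cK (a - b) + (T - cK a) by rewrite rmorphB /=; ring.
have ab0 : cK (a - b) != 0 by rewrite cK_neq0 subr_eq0.
rewrite (valD_dominant hv ab0 _).2 vc // vgeE ?Tsub_neq0 //.
by rewrite [v _]vx; lia.
Qed.

(** A nonzero function is a power of the parameter times a unit with residue in
    [k]; this form is kept by products and inverses. *)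
Lemma ratfun_expansion f : f != 0 ->
  exists (n : int) (a : k) (g : K), [/\ a != 0, vge v 1 g & f = param x ^ n * (cK a + g)].
Proof.
have p0 := param_neq0 x.
have vge_c a : vge v 0 (cK a) by rewrite /vge vc lexx orbT.
move: f; apply: ratfun_ind.
- by move=> a a0; exists 0, a, 0; rewrite vge0 mul1r addr0.
- move=> b; case: x v_param => [a|] vx.
    have vx1 : vge v 1 (T - cK a) by rewrite /vge [v _]vx; apply/orP; right; lia.
    have [<-|ab] := eqVneq a b.
      by exists 1, 1, 0; rewrite vge0 oner_neq0 addr0 rmorph1 mulr1.
    exists 0, (a - b), (T - cK a); rewrite subr_eq0; split=> //.
    by rewrite rmorphB /= expr0z mul1r; ring.
  exists (- 1), 1, (- cK b * T^-1); split; first exact: oner_neq0.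
    rewrite -[1]add0r vgeM // ?vgeN //; rewrite /vge [v _]vx; apply/orP; right; lia.
  rewrite /param exprN1 invrK rmorph1 mulrDr mulr1 mulrC -mulrA mulVf ?T_neq0 //.
  by rewrite mulr1.
- move=> f g f0 g0 [n [a [f' [a0 hf ->]]]] [m [b [g' [b0 hg ->]]]].
  exists (n + m), (a * b), (cK a * g' + f' * (cK b + g')).
  rewrite mulf_neq0 //; split=> //.
    apply: vgeD => //; first by rewrite vgeMl.
    by have := vgeM hv hf (vgeD hv (vge_c b) (vge_le ler01 hg)); rewrite addr0.
  by rewrite (rmorphM cK) (expansionM _ _ _ _ _ _ p0).
- move=> f f0 [n [a [g [a0 hg fE]]]].
  have ca : cK a != 0 by rewrite cK_neq0.
  have [s0 vs] : cK a + g != 0 /\ v (cK a + g) = v (cK a).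
    by apply: valD_dominant => //; rewrite vc add0r.
  exists (- n), a^-1, (- (cK a^-1 * (cK a + g)^-1 * g)); split.
  + by rewrite invr_neq0.
  + by rewrite vgeN // vgeMl // vgeMl // /vge valV // vs vc oppr0 lexx orbT.
  rewrite fE invfM invr_expz; congr (_ * _).
  have ca' : cK a^-1 = (cK a)^-1 := fmorphV cK a.
  by rewrite ca'; exact: (inv_addE ca s0).
Qed.

Lemma ratfun_residue f : vge v 0 f -> exists a, vge v 1 (f - cK a).
Proof.
have [->|f0] := eqVneq f 0; first by exists 0; rewrite rmorph0 subr0 vge0.
have [n [a [g [a0 hg ->]]]] := ratfun_expansion f0.
have ca : cK a != 0 by rewrite cK_neq0.
have [s0 vs] : cK a + g != 0 /\ v (cK a + g) = v (cK a).
  by apply: valD_dominant => //; rewrite vc add0r.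
have pn : param x ^ n != 0 by rewrite expfz_neq0 ?param_neq0.
have nz := mulf_neq0 pn s0.
have vE : v (param x ^ n * (cK a + g)) = n * e%:Z.
  by rewrite (valM hv pn s0) vs vc addr0 (valXz hv n (param_neq0 x)) v_param.
rewrite (vgeE v 0 nz) vE pmulr_lge0 ?ltz_nat // le_eqVlt => /orP[/eqP n0|n0].
  by exists a; rewrite -n0 expr0z mul1r addrC addKr.
exists 0; rewrite rmorph0 subr0 (vgeE v 1 nz) vE.
by move: n0 e_gt0; clear; nia.
Qed.

End AboveAPoint.

(** The ultrametric inequality alone determines the order of a linear polynomial
    at a valuation centred at [x], and linear polynomials generate. *)
Lemma val_ratfun x (v : K -> int) (e : nat) : valuation v -> (forall a, v (cK a) = 0) ->
  (0 < e)%N -> v (param x) = e%:Z -> forall f, v f = e%:Z * ordK x f.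
Proof.
move=> hv vc e0 vx f; have ho := valuation_ordK x.
have [->|] := eqVneq f 0; first by rewrite ordK0 mulr0; case: hv.
move: f; apply: ratfun_ind.
- by move=> a a0; rewrite vc ordK_const mulr0.
- move=> b; rewrite (val_linear hv vc e0 vx).
  rewrite (val_linear ho (ordK_const x) (isT : (0 < 1)%N) (ordK_param x)).
  by case: (x) => [a|]; first case: ifP; lia.
- by move=> f g f0 g0 vf vg; rewrite (valM hv f0 g0) (valM ho f0 g0) vf vg mulrDr.
- by move=> f f0 vf; rewrite (valV hv) (valV ho) vf mulrN.
Qed.

(** The zeros and poles of a linear polynomial balance, the pole being at infinity.
    The finite set that carries the sum is free to grow, so that the supports of
    two factors can be merged. *)
Lemma degree_ordK f : f != 0 -> exists s : seq (option k),
  (forall x, x \notin s -> ordK x f = 0) /\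
  forall s', uniq s' -> {subset s <= s'} -> \sum_(x <- s') ordK x f = 0.
Proof.
move: f; apply: ratfun_ind.
- move=> a a0; exists [::]; split=> [x _|s' _ _]; first exact: ordK_const.
  by rewrite big1 // => x _; apply: ordK_const.
- move=> b; exists [:: None; Some b].
  have oE x : ordK x (T - cK b) = if x is Some a then (a == b)%:Z else - 1.
    rewrite (val_linear (valuation_ordK x) (ordK_const x) (isT : (0 < 1)%N) (ordK_param x)).
    by case: x => [a|] //; case: eqP.
  have oE' x : ordK x (T - cK b) = (x == Some b)%:Z - (x == None)%:Z.
    by rewrite oE; case: x => [a|] //; rewrite subr0.
  split=> [x|s' us' hs'].
    by rewrite oE' !inE negb_or => /andP[/negPf -> /negPf ->].
  have indicator y : y \in s' -> \sum_(x <- s') (x == y)%:Z = 1.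
    move=> ys'; rewrite (bigD1_seq y) //= eqxx big1 ?addr0 // => x /negPf -> //.
  under eq_bigr do rewrite oE'.
  by rewrite sumrB !indicator ?subrr ?hs' ?inE ?eqxx ?orbT.
- move=> f g f0 g0 [s [hs Hs]] [s' [hs' Hs']]; exists (s ++ s'); split=> [x|r ur hr].
    rewrite mem_cat negb_or => /andP[xs xs'].
    by rewrite (valM (valuation_ordK x) f0 g0) hs // hs'.
  under eq_bigr => x _ do rewrite (valM (valuation_ordK x) f0 g0).
  rewrite big_split /= Hs ?Hs' ?addr0 // => x xs; apply: hr; rewrite mem_cat xs ?orbT //.
- move=> f f0 [s [hs Hs]]; exists s; split=> [x xs|r ur hr].
    by rewrite (valV (valuation_ordK x)) hs ?oppr0.
  under eq_bigr => x _ do rewrite (valV (valuation_ordK x)).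
  by rewrite sumrN Hs ?oppr0.
Qed.

End Line.

(** * Valuations as limits of approximate evaluations *)

Section LimitValuation.

Variables (E L : fieldType) (R : comNzRingType).
Variables (o : E -> int) (pi : {rmorphism R -> L}) (ev : nat -> {rmorphism R -> E}).
Hypothesis ho : valuation o.
Hypothesis pi_surj : forall y, exists P, pi P = y.
Hypothesis ev_ker : forall P, pi P = 0 -> exists C : int, forall N : nat, vge o (N%:Z - C) (ev N P).
Hypothesis ev_bounded : forall P, exists C : int, forall N : nat, vge o (- C) (ev N P).
Hypothesis ev_cauchy : forall P, exists C : int, forall N : nat,
  vge o (N%:Z - C) (ev N.+1 P - ev N P).

Definition ev_order P n := exists N0 : nat, forall N, (N0 <= N)%N -> ev N P != 0 /\ o (ev N P) = n.

Lemma ev_order_uniq P n m : ev_order P n -> ev_order P m -> n = m.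
Proof.
move=> [N1 h1] [N2 h2]; have [_ <-] := h1 (maxn N1 N2) (leq_maxl _ _).
by have [_ <-] := h2 (maxn N1 N2) (leq_maxr _ _).
Qed.

(** The orders are bounded below, and above thanks to an approximate inverse;
    once the increments are smaller than this bound the orders are constant. *)
Lemma ev_order_exists P : pi P != 0 -> exists n, ev_order P n.
Proof.
move=> P0; have [Q piQ] := pi_surj (pi P)^-1.
have [C1 h1] : exists C : int, forall N : nat, vge o (N%:Z - C) (ev N (P * Q - 1)).
  by apply: ev_ker; rewrite rmorphB rmorphM piQ rmorph1 divff // subrr.
have [C2 h2] := ev_bounded Q; have [C3 h3] := ev_cauchy P.
pose N0 := (`|C1| + `|C2| + `|C3|).+1%N.
have small N : (N0 <= N)%N -> ev N P != 0 /\ o (ev N P) <= C2.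
  move=> le; have [s0 os] : 1 + ev N (P * Q - 1) != 0 /\ o (1 + ev N (P * Q - 1)) = o 1.
    apply: valD_dominant => //; first exact: oner_neq0.
    by rewrite val1 //; apply: vge_le (h1 N); move: le; rewrite /N0; clear; lia.
  have pq : 1 + ev N (P * Q - 1) = ev N P * ev N Q.
    by rewrite rmorphB rmorphM rmorph1 addrC subrK.
  move: s0 os; rewrite pq mulf_eq0 negb_or => /andP[p0 q0].
  rewrite valM // val1 // => opq; split=> //.
  by have := h2 N; rewrite vgeE //; move: opq; clear; lia.
have step N : (N0 <= N)%N -> o (ev N.+1 P) = o (ev N P).
  move=> le; have [p0 op] := small N le.
  rewrite -[ev N.+1 P](subrK (ev N P)) addrC; apply: (valD_dominant ho p0 _).2.
  apply: vge_le (h3 N); move: le op; rewrite /N0; clear; lia.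
exists (o (ev N0 P)), N0 => N le; split; first exact: (small N le).1.
rewrite -(subnKC le); elim: (N - N0)%N => [|j IH]; first by rewrite addn0.
by rewrite addnS step ?IH // leq_addr.
Qed.

Lemma ev_order_eq P Q n : pi P != 0 -> pi P = pi Q -> ev_order P n -> ev_order Q n.
Proof.
move=> P0 PQ [N1 h1].
have [C hC] : exists C : int, forall N : nat, vge o (N%:Z - C) (ev N (Q - P)).
  by apply: ev_ker; rewrite rmorphB PQ subrr.
exists (N1 + `|C| + `|n|).+1 => N le.
have [|p0 op] := h1 N; first by move: le; clear; lia.
have -> : ev N Q = ev N P + ev N (Q - P) by rewrite rmorphB addrC subrK.
rewrite -op; apply: valD_dominant => //; apply: vge_le (hC N).
by rewrite op; move: le; clear; lia.
Qed.

Lemma limit_valuation : exists w : L -> int, valuation w /\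
  forall P, pi P != 0 -> ev_order P (w (pi P)).
Proof.
have /boolp.choice[w hw] y : exists n : int, (y = 0 -> n = 0) /\
    forall P, pi P = y -> y != 0 -> ev_order P n.
  have [P Py] := pi_surj y; have [->|y0] := eqVneq y 0.
    by exists 0; split=> // Q _; rewrite eqxx.
  have [n hn] : exists n, ev_order P n by apply: ev_order_exists; rewrite Py.
  exists n; split=> [|Q Qy _]; first by move/eqP; rewrite (negPf y0).
  by apply: (ev_order_eq _ _ hn); rewrite Py.
exists w; split=> [|P P0]; last by apply: (hw _).2.
split; last exact: (hw 0).1.
- move=> f g; have [P <-] := pi_surj f; have [Q <-] := pi_surj g => P0 Q0.
  have [N1 h1] := (hw _).2 P erefl P0; have [N2 h2] := (hw _).2 Q erefl Q0.
  have PQ0 : pi (P * Q) != 0 by rewrite rmorphM mulf_neq0.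
  rewrite -rmorphM; apply: (ev_order_uniq ((hw _).2 (P * Q) erefl PQ0)).
  exists (maxn N1 N2) => N; rewrite geq_max => /andP[/h1[p0 op] /h2[q0 oq]].
  by rewrite rmorphM mulf_neq0 // valM // op oq.
- move=> f g; have [P <-] := pi_surj f; have [Q <-] := pi_surj g.
  rewrite -rmorphD => P0 Q0 S0.
  have [N1 h1] := (hw _).2 P erefl P0; have [N2 h2] := (hw _).2 Q erefl Q0.
  have [N3 h3] := (hw _).2 (P + Q) erefl S0.
  pose N := maxn N1 (maxn N2 N3).
  have [|p0 <-] := h1 N; first exact: leq_maxl.
  have [|q0 <-] := h2 N; first by rewrite /N maxnCA leq_maxl.
  have [|s0 <-] := h3 N; first by rewrite /N maxnA leq_maxr.
  by move: s0; rewrite rmorphD; case: ho => _ + _; apply.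
Qed.

End LimitValuation.

(** * Newton approximation of roots *)

Section Newton.

Variables (E : fieldType) (o : E -> int).
Hypothesis ho : valuation o.

Lemma expr_taylor (V D : E) (j : nat) : vge o 0 V -> vge o 0 D ->
  exists2 R, vge o 0 R & (V + D) ^+ j.+1 = V ^+ j.+1 + j.+1%:R * V ^+ j * D + D ^+ 2 * R.
Proof.
move=> hV hD; have vX i : vge o 0 (V ^+ i).
  by elim: i => [|i IH]; rewrite ?expr0 ?exprS ?vgeMl // /vge val1 // lexx orbT.
have vn i : vge o 0 (i%:R : E).
  elim: i => [|i IH]; first by rewrite vge0.
  by rewrite -natr1 vgeD // /vge val1 // lexx orbT.
elim: j => [|j [R hR IH]].
  by exists 0; rewrite ?vge0 // !expr1 expr0; ring.
exists (j.+1%:R * V ^+ j + (V + D) * R); first by rewrite vgeD // vgeMl // vgeD.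
rewrite exprS IH !exprS -[j.+2%:R]natr1; ring.
Qed.

(** With [m] and [V] units, the correction [- (V ^+ m - A) / (m V ^+ (m - 1))]
    squares the error. *)
Lemma newton_root (m : nat) (A V0 : E) : (0 < m)%N -> m%:R != 0 :> E -> o m%:R = 0 ->
  V0 != 0 -> o V0 = 0 -> vge o 1 (V0 ^+ m - A) ->
  exists V : nat -> E, forall N : nat,
    [/\ V N != 0, o (V N) = 0, vge o (N%:Z + 1) (V N ^+ m - A)
      & vge o (N%:Z + 1) (V N.+1 - V N)].
Proof.
case: m => // m _ m0 om V00 oV0 hV0.
pose inv N V := [/\ V != 0, o V = 0 & vge o (N%:Z + 1) (V ^+ m.+1 - A)].
have /boolp.choice[st hst] (NV : nat * E) : exists V', inv NV.1 NV.2 ->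
    inv NV.1.+1 V' /\ vge o (NV.1%:Z + 1) (V' - NV.2).
  case: NV => N V /=; have [[V0' oV hV]|] := EM (inv N V); last by exists 0.
  pose M := m.+1%:R * V ^+ m; have M0 : M != 0 by rewrite mulf_neq0 ?expf_neq0.
  have oM : o M = 0 by rewrite valM ?expf_neq0 // om valX // oV mulr0.
  pose D := - (V ^+ m.+1 - A) / M.
  have hD : vge o (N%:Z + 1) D.
    rewrite -[X in vge o X]addr0 vgeM ?vgeN //.
    by rewrite /vge valV // oM oppr0 lexx orbT.
  have hD0 : vge o 0 D by apply: vge_le hD.
  have hVV : vge o 0 V by rewrite /vge oV lexx orbT.
  have [R hR RE] := expr_taylor m hVV hD0.
  exists (V + D) => _; rewrite addrC addrK; split=> //.
  have [s0 os] : V + D != 0 /\ o (V + D) = o V.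
    by apply: valD_dominant => //; rewrite oV add0r; apply: vge_le hD; clear; lia.
  rewrite addrC; split; rewrite ?os //.
  have -> : (V + D) ^+ m.+1 - A = D ^+ 2 * R.
    by rewrite RE -/M /D; field; rewrite ?M0.
  have := vgeM ho (vgeM ho hD hD) hR; rewrite -expr2; apply: vge_le.
  by clear; lia.
pose V := fix V N := if N is N'.+1 then st (N', V N') else V0.
have hV N : inv N (V N).
  by elim: N => [|N IH]; [split | exact: (hst (N, V N) IH).1].
exists V => N; have [n0 oN hN] := hV N; split=> //.
exact: (hst (N, V N) (hV N)).2.
Qed.

End Newton.

(** * Existence of places *)

Section KummerExtension.

Variables (K : fieldType) (L : fieldExtType K) (E : fieldType).
Variables (u : L) (m : nat) (G : K) (phi : {rmorphism K -> E}) (o : E -> int) (A B V0 : E).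
Hypothesis ho : valuation o.
Hypothesis u0 : u != 0.
Hypothesis gen_u : forall y, exists P : {poly K}, (map_poly (in_alg L) P).[u] = y.
Hypothesis ker_u : forall P : {poly K}, (map_poly (in_alg L) P).[u] = 0 -> ('X^m - G%:P) %| P.
Hypotheses (m_gt0 : (0 < m)%N) (m0 : m%:R != 0 :> E) (om : o m%:R = 0).
Hypotheses (B0 : B != 0) (phiG : phi G = A * B ^+ m).
Hypotheses (V00 : V0 != 0) (oV0 : o V0 = 0) (hV0 : vge o 1 (V0 ^+ m - A)).

(** A valuation [o] pulled back to [K] along [phi] extends to the Kummer
    extension [K(u)] when [phi G] is approximately an [m]-th power: [u] is sent to
    better and better approximations [B * V N] of an [m]-th root. *)
Lemma kummer_extension : exists w : L -> int,
  [/\ valuation w, forall f, f != 0 -> w f%:A = o (phi f) & w u = o B].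
Proof.
have [V hV] := newton_root ho m_gt0 m0 om V00 oV0 hV0.
have oBV N : o (B * V N) = o B by have [n0 oN _ _] := hV N; rewrite valM // oN addr0.
pose pi : {rmorphism {poly K} -> L} := horner_eval u \o map_poly (in_alg L).
pose ev N : {rmorphism {poly K} -> E} := horner_eval (B * V N) \o map_poly phi.
have evE N P : ev N P = (map_poly phi P).[B * V N] by [].
have ev_rec N P a : ev N (P * 'X + a%:P) = ev N P * (B * V N) + phi a.
  by rewrite !evE rmorphD rmorphM /= map_polyX map_polyC !hornerE.
have bounded P : exists C : int, forall N : nat, vge o (- C) (ev N P).
  elim/poly_ind: P => [|P a [C hC]]; first by exists 0 => N; rewrite rmorph0 vge0.
  exists (`|C| + `|o B| + `|o (phi a)|)%:Z => N; rewrite ev_rec; apply: vgeD => //.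
    apply: vge_le (vgeM ho (hC N) (vge_val o _)); rewrite oBV; clear; lia.
  by apply: vge_le (vge_val o _); clear; lia.
have [||||w [hw limw]] := @limit_valuation E L {poly K} o pi ev ho.
- exact: gen_u.
- move=> P /ker_u/dvdpP[Q ->]; have [C hC] := bounded Q.
  exists (`|C| + `|m%:Z * o B|)%:Z => N; have [_ _ hN _] := hV N.
  have -> : ev N (Q * ('X^m - G%:P)) = ev N Q * (B ^+ m * (V N ^+ m - A)).
    have phiQ : map_poly phi ('X^m - G%:P) = 'X^m - (phi G)%:P.
      by rewrite rmorphB /= map_polyXn map_polyC.
    rewrite [LHS]rmorphM; congr (_ * _); rewrite evE phiQ phiG !hornerE exprMn.
    by rewrite mulrBr (mulrC A).
  apply: vge_le (vgeM ho (hC N) (vgeM ho (vge_val o (B ^+ m)) hN)).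
  by rewrite valX //; clear; lia.
- exact: bounded.
- elim/poly_ind => [|P a [C hC]].
    by exists 0 => N; rewrite (rmorph0 (ev N.+1)) (rmorph0 (ev N)) subrr vge0.
  have [C' hC'] := bounded P.
  exists (`|C| + `|C'| + `|o B|)%:Z => N; have [_ _ _ hN] := hV N.
  have -> : ev N.+1 (P * 'X + a%:P) - ev N (P * 'X + a%:P) =
      (ev N.+1 P - ev N P) * (B * V N.+1) + ev N P * (B * (V N.+1 - V N)).
    by rewrite !ev_rec; ring.
  apply: vgeD => //.
    by apply: vge_le (vgeM ho (hC N) (vge_val o _)); rewrite oBV; clear; lia.
  by apply: vge_le (vgeM ho (hC' N) (vgeM ho (vge_val o B) hN)); clear; lia.
exists w; split=> // [f f0|].
  have piE : pi f%:P = f%:A by rewrite /pi /= map_polyC /horner_eval hornerC.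
  have [|N hN] := limw f%:P; first by rewrite piE scaler_eq0 oner_eq0 orbF.
  by have [_] := hN N (leqnn _); rewrite piE evE map_polyC hornerC => <-.
have piE : pi 'X = u by rewrite /pi /= map_polyX /horner_eval hornerX.
have [|N hN] := limw 'X; first by rewrite piE.
by have [_] := hN N (leqnn _); rewrite piE evE map_polyX hornerX oBV => <-.
Qed.

End KummerExtension.

Section Substitution.

Variables (k : closedFieldType) (E : fieldType) (cE : {rmorphism k -> E}).
Local Notation K := {fraction {poly k}}.
Local Notation cK := (@tofrac {poly k} \o polyC).

Lemma ratfun_substitution (xi : E) : (forall b, xi != cE b) ->
  exists phi : {rmorphism K -> E}, (forall a, phi (cK a) = cE a) /\ phi (tofrac 'X) = xi.
Proof.
move=> xi_tr; pose g : {rmorphism {poly k} -> E} := horner_eval xi \o map_poly cE.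
have gE p : g p = (map_poly cE p).[xi] by [].
have g_neq0 p : p != 0 -> g p != 0.
  move=> p0; have [rs ->] := closed_field_poly_normal p.
  rewrite gE map_polyZ hornerZ mulf_neq0 ?fmorph_eq0 ?lead_coef_eq0 //.
  rewrite rmorph_prod horner_prod prodf_seq_neq0; apply/allP => b _ /=.
  by rewrite rmorphB /= map_polyX map_polyC !hornerE subr_eq0 xi_tr.
have ginj : injective g.
  move=> p q /eqP; rewrite -subr_eq0 -rmorphB => h; apply/eqP; rewrite -subr_eq0.
  by apply: contraTT h; apply: g_neq0.
have [phi hphi] := fraction_lift ginj; exists phi; split=> [a|].
  by rewrite /= hphi gE map_polyC hornerC.
by rewrite hphi gE map_polyX hornerX.
Qed.

Variables (o : E -> int) (S : E).
Hypothesis ho : valuation o.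
Hypothesis oc : forall a, o (cE a) = 0.
Hypothesis oS : o S = 1.

(** The coordinate is sent to [cE a + S ^+ e], or to [S ^- e] at infinity, so that
    pulling [o] back along the substitution gives [e] times the order at [x]. *)
Lemma ramified_substitution (x : option k) (e : nat) : (0 < e)%N ->
  exists phi : {rmorphism K -> E},
    (forall a, phi (cK a) = cE a) /\ phi (param x) = S ^+ e.
Proof.
move=> e0; have S0 : S != 0.
  by apply/eqP => S0; move: oS; rewrite S0; case: ho => _ _ ->.
have oSe : o (S ^+ e) = e%:Z by rewrite valX // oS mulr1.
have Sc b : S ^+ e != cE b.
  by apply: contraTneq e0 => Sb; move: oSe; rewrite Sb oc => -[<-].
case: x => [a|].
  have [b|phi [phic phiT]] := @ratfun_substitution (cE a + S ^+ e).
    by rewrite addrC -subr_eq0 -addrA -[_ + - _]opprB -rmorphB subr_eq0 Sc.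
  by exists phi; split=> //; rewrite rmorphB phic phiT addrAC subrr add0r.
have [b|phi [phic phiT]] := @ratfun_substitution (S ^- e).
  rewrite -(inj_eq invr_inj) invrK -fmorphV; exact: Sc.
by exists phi; split=> //; rewrite fmorphV phiT invrK.
Qed.

End Substitution.

Section PlaceExistence.

Variables (k : closedFieldType) (L : fieldExtType {fraction {poly k}}).
Local Notation K := {fraction {poly k}}.
Local Notation cK := (@tofrac {poly k} \o polyC).
Variables (u : L) (m : nat) (G : K).
Hypothesis gen_u : forall y, exists P : {poly K}, (map_poly (in_alg L) P).[u] = y.
Hypothesis ker_u : forall P : {poly K}, (map_poly (in_alg L) P).[u] = 0 -> ('X^m - G%:P) %| P.
Hypotheses (m_gt0 : (0 < m)%N) (m0 : m%:R != 0 :> k) (u0 : u != 0) (G0 : G != 0).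

(** With [m / e] the gcd of [m] and the order of [G], the substitution of [S ^+ e]
    for the parameter turns [G] into the [m]-th power of [S ^ g0] times a unit, and
    the residue of this unit has an [m]-th root in [k]. *)
Lemma place_exists (x : option k) : exists w : L -> int,
  [/\ valuation w, forall a, w (cK a)%:A = 0, 0 < w (param x)%:A & exists s, w s = 1].
Proof.
pose o := ordK (Some (0 : k)); pose S := param (Some (0 : k)).
have ho : valuation o := valuation_ordK _.
have oc a : o (cK a) = 0 := ordK_const _ a.
have oS : o S = 1 := ordK_param _.
have S0 : S != 0 := param_neq0 _.
pose g := ordK x G; pose dd := gcdn m `|g|.
pose e := (m %/ dd)%N; pose g0 := (g %/ dd%:Z)%Z.
have dd0 : (0 < dd)%N by rewrite gcdn_gt0 m_gt0.
have em : m = (e * dd)%N by rewrite divnK ?dvdn_gcdl.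
have gE : g = g0 * dd%:Z by rewrite divzK // dvdzE dvdn_gcdr.
have e0 : (0 < e)%N by move: m_gt0; rewrite em muln_gt0 => /andP[].
have cop : coprimez e%:Z g0.
  rewrite /coprimez /gcdz /= eqz_nat -(eqn_pmul2r dd0) mul1n muln_gcdl -em.
  by rewrite -[(`|g0| * dd)%N]/(`|g0| * `|dd%:Z|)%N -abszM -gE.
have [phi [phic phix]] := ramified_substitution ho oc oS x e0.
have oinj f : f != 0 -> phi f != 0 by rewrite fmorph_eq0.
have hophi : valuation (o \o phi).
  split=> [f h f0 h0|f h f0 h0 s0|] /=.
  - rewrite (rmorphM phi) (valM ho (oinj _ f0) (oinj _ h0)); exact: erefl.
  - case: ho => _ hD _; have := oinj _ s0; rewrite (rmorphD phi).
    exact: hD (oinj _ f0) (oinj _ h0).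
  - rewrite (rmorph0 phi); exact: ordK0.
have ophi f : o (phi f) = e%:Z * ordK x f.
  apply: (val_ratfun hophi) => //= [a|]; first by rewrite phic oc.
  by rewrite phix (valX ho e S0) oS mulr1.
pose B := S ^ g0; have B0 : B != 0 by rewrite expfz_neq0.
have oB : o B = g0 by rewrite /B (valXz ho g0 S0) oS mulr1.
have Bm0 : B ^+ m != 0 by rewrite expf_neq0.
have pG0 := oinj _ G0.
pose A := phi G / B ^+ m; have A0 : A != 0 := mulf_neq0 pG0 (invr_neq0 Bm0).
have oA : o A = 0.
  rewrite /A (valM ho pG0 (invr_neq0 Bm0)) (valV ho) (valX ho m B0) ophi oB -/g.
  by rewrite gE [in m%:Z]em PoszM; clear; ring.
have Aint : vge o 0 A by rewrite /vge oA lexx orbT.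
have [a ha] := ratfun_residue ho oc (isT : (0 < 1)%N) oS Aint.
have a0 : a != 0.
  apply: contraTneq ha => ->; rewrite rmorph0 subr0 (vgeE o 1 A0) oA.
  by [].
have [b hb] : exists b, b ^+ m = a.
  have /closed_rootP[b] : size ('X^m - a%:P) != 1%N.
    by rewrite size_XnsubC // eqSS -lt0n.
  by rewrite /root !hornerE subr_eq0 => /eqP; exists b.
have b0 : b != 0.
  by apply: contra_neq a0 => b0; rewrite -hb b0 expr0n eqn0Ngt m_gt0.
have V00 : cK b != 0 by rewrite cK_neq0.
have hV0 : vge o 1 (cK b ^+ m - A).
  by rewrite -(rmorphXn cK) hb -opprB (vgeN ho).
have mK : m%:R != 0 :> K by rewrite -(rmorph_nat cK) cK_neq0.
have om : o m%:R = 0 by rewrite -(rmorph_nat cK) oc.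
have phiG : phi G = A * B ^+ m := esym (divfK Bm0 (phi G)).
have [w [hw wbase wu]] := kummer_extension ho u0 gen_u ker_u m_gt0 mK om B0 phiG V00 (oc b) hV0.
have wx : w (param x)%:A = e%:Z by rewrite wbase ?param_neq0 // ophi ordK_param mulr1.
exists w; split=> // [c||].
- have [->|c0] := eqVneq c 0; first by rewrite rmorph0 scale0r; case: hw.
  by rewrite wbase ?cK_neq0 // phic oc.
- by rewrite wx.
have /coprimezP[[i j] /= ij] := cop.
have px0 : (param x)%:A != 0 :> L by rewrite scaler_eq0 oner_eq0 orbF param_neq0.
exists ((param x)%:A ^ i * u ^ j).
by rewrite (valM hw) ?expfz_neq0 // !(valXz hw) // wx wu oB.
Qed.

End PlaceExistence.

(** * Differentials *)

Section Differentials.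

Variables (K : fieldType) (L : splittingFieldType K) (Om : lmodType L) (d : L -> Om) (w0 : Om).
Hypothesis galL : galois 1%AS {:L}.
Hypothesis dD : forall f g, d (f + g) = d f + d g.
Hypothesis dM : forall f g, d (f * g) = f *: d g + g *: d f.
Hypothesis d_base : forall f, f \in 1%VS -> exists a, d f = a *: w0.

Let spanned w := exists a : L, w = a *: w0.

Let spannedD w w' : spanned w -> spanned w' -> spanned (w + w').
Proof. by move=> [a ->] [b ->]; exists (a + b); rewrite scalerDl. Qed.

Let spannedZ c w : spanned w -> spanned (c *: w).
Proof. by move=> [a ->]; exists (c * a); rewrite scalerA. Qed.

Lemma der0 : d 0 = 0.
Proof. by apply: (@addrI _ (d 0)); rewrite -dD !addr0. Qed.

Lemma der1 : d 1 = 0.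
Proof.
apply: (@addrI _ (d 1)); rewrite addr0 -[in RHS](mulr1 1) dM.
by rewrite scale1r.
Qed.

Lemma derV f : f != 0 -> d f^-1 = - f ^- 2 *: d f.
Proof.
move=> f0; have : f *: d f^-1 + f^-1 *: d f = 0 by rewrite -dM divff // der1.
move/eqP; rewrite addr_eq0 => /eqP h.
rewrite -[LHS]scale1r -(mulVf f0) -scalerA h scalerN scaleNr scalerA.
by rewrite -invfM expr2.
Qed.

Lemma der_poly (P : {poly L}) f : (forall i, P`_i \in 1%VS) ->
  exists2 w, spanned w & d P.[f] = P^`().[f] *: d f + w.
Proof.
move: P; apply: poly_ind => [|P a IH] hP.
  exists 0; first by exists 0; rewrite scale0r.
  by rewrite deriv0 !horner0 der0 scale0r addr0.
have coef_MXaddC i : (P * 'X + a%:P)`_i = (if i is j.+1 then P`_j else a).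
  by case: i => [|i]; rewrite coefD coefMX coefC /= ?add0r ?addr0.
have [i|w hw IHw] := IH; first by have := hP i.+1; rewrite coef_MXaddC.
have [b hb] : spanned (d a) by apply: d_base; have := hP 0%N; rewrite coef_MXaddC.
exists (f *: w + d a); first by apply: spannedD; [apply: spannedZ | exists b].
rewrite derivD derivM derivX derivC addr0 mulr1 !hornerE dD dM IHw.
rewrite scalerDr scalerA scalerDl [f * _]mulrC !addrA.
by congr (_ + _ + _); apply: addrC.
Qed.

(** Separability: the derivative of the minimal polynomial of [f] does not vanish
    at [f], so [d f] can be solved for. *)
Lemma differentials_spanned f : exists a, d f = a *: w0.
Proof.
set P := minPoly 1%AS f.
have P1 i : P`_i \in 1%VS by apply/polyOverP: (minPolyOver 1%AS f) i.
have [w hw] := der_poly f P1.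
have -> : P.[f] = 0 by apply/rootP; apply: root_minPoly.
rewrite der0 => /esym/eqP; rewrite addr_eq0 => /eqP dE.
have sepf : separable_element 1%AS f.
  by case/and3P: galL => _ /separableP sepL _; apply: sepL; apply: memvf.
have P'0 : P^`().[f] != 0 by have := separable_root_der 1%AS f; rewrite sepf.
have : spanned (P^`().[f]^-1 *: (P^`().[f] *: d f)).
  by apply: spannedZ; rewrite dE -scaleN1r; apply: spannedZ.
by rewrite scalerA mulVf // scale1r.
Qed.

Lemma derivation_of_differential : w0 != 0 ->
  exists D : L -> L, [/\ forall f, d f = D f *: w0,
    forall f g, D (f + g) = D f + D g & forall f g, D (f * g) = f * D g + g * D f].
Proof.
move=> w00; have inj a b : a *: w0 = b *: w0 -> a = b.
  by move/eqP; rewrite -subr_eq0 -scalerBl scaler_eq0 (negPf w00) orbF subr_eq0 => /eqP.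
have /boolp.choice[D hD] := differentials_spanned.
exists D; split=> // f g; apply: inj; rewrite -hD.
  by rewrite scalerDl -!hD.
by rewrite scalerDl -!scalerA -!hD.
Qed.

End Differentials.

(** * The local invariants of a deformation datum *)

Section LocalInvariants.

Variables (k : closedFieldType) (L : splittingFieldType {fraction {poly k}}).
Local Notation K := {fraction {poly k}}.
Local Notation cK := (@tofrac {poly k} \o polyC).
Local Notation c := (@GRing.in_alg _ L \o cK).
Local Notation H := ('Gal({:L} / 1)%g).

Lemma local_paramE x : local_param L x = (param x)%:A.
Proof.
case: x => [a|] /=; first by rewrite scalerBl.
exact: esym (fmorphV (GRing.in_alg L) _).
Qed.

Lemma point_valuation (v : L -> int) : is_point v -> valuation v.
Proof. by case. Qed.

Lemma base_neq0 (f : K) : f != 0 -> f%:A != 0 :> L.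
Proof. by rewrite scaler_eq0 oner_eq0 orbF. Qed.

Lemma valuation_base (v : L -> int) : valuation v -> valuation (fun f : K => v f%:A).
Proof.
move=> hv; split=> [f g f0 g0|f g f0 g0 s0|].
- by rewrite [(f * g)%:A](rmorphM (GRing.in_alg L)) (valM hv (base_neq0 f0) (base_neq0 g0)).
- have := base_neq0 s0; rewrite scalerDl; case: hv => _ hD _.
  exact: hD (base_neq0 f0) (base_neq0 g0).
- by rewrite scale0r; case: hv.
Qed.

Lemma in_base (f : K) : f%:A \in (1%VS : {vspace L}).
Proof. by rewrite rpredZ ?mem1v. Qed.

Section AtAPlace.

Variables (v : L -> int) (x : option k).
Hypothesis hpt : is_point v.
Hypothesis habove : lies_above v x.

Let hv : valuation v := point_valuation hpt.
Definition ramification := `|v (local_param L x)|%N.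
Local Notation e := ramification.

Lemma ram_gt0 : (0 < e)%N.
Proof. by rewrite absz_gt0 gt_eqF. Qed.

Lemma val_param : v (param x)%:A = e%:Z.
Proof. by rewrite -local_paramE gez0_abs // ltW. Qed.

Lemma point_const a : v (c a) = 0.
Proof. by case: hpt => _ _ /(_ a). Qed.

Lemma val_base (f : K) : v f%:A = e%:Z * ordK x f.
Proof.
exact: (val_ratfun (valuation_base hv) point_const ram_gt0 val_param).
Qed.

Lemma point_residue (f : L) : f \in 1%VS -> vge v 0 f -> exists a, vge v 1 (f - c a).
Proof.
have vgeA n (h : K) : vge (fun f : K => v f%:A) n h = vge v n h%:A.
  by rewrite /vge scaler_eq0 oner_eq0 orbF.
move=> /vlineP[h ->]; rewrite -vgeA => hh.
have [a ha] := ratfun_residue (valuation_base hv) point_const ram_gt0 val_param hh.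
by exists a; move: ha; rewrite vgeA scalerBl.
Qed.

Lemma dvd_val_base f : f \in 1%VS -> f != 0 -> (e%:Z %| v f)%Z.
Proof. by move=> /vlineP[h ->] _; rewrite val_base dvdz_mulr. Qed.

Lemma point_surj : exists s, v s = 1. Proof. by case: hpt. Qed.

Variables (u : L) (X : gal_of {:L} -> k) (D : L -> L).
Hypothesis galL : galois 1%AS {:L}.
Hypothesis u0 : u != 0.
Hypothesis hX : forall b, b \in H -> b u = c (X b) * u.
Hypothesis Xinj : {in H &, injective X}.
Hypothesis hm : (#|H|%:R : k) != 0.
Hypothesis DD : forall f g, D (f + g) = D f + D g.
Hypothesis DM : forall f g, D (f * g) = f * D g + g * D f.
Hypothesis Dc : forall a, D (c a) = 0.
Hypothesis Dt : D (Defs.coord L) = 1.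

Let cbase a : c a \in 1%VS. Proof. exact: in_base. Qed.

Lemma card_point_stabilizer : #|stabilizer v| = e.
Proof.
apply: (card_stabilizer cbase galL u0 hX Xinj hm hv point_const point_residue
  (in_base _) ram_gt0 val_param dvd_val_base point_surj) => b.
rewrite inE; split=> [/andP[bH /asboolP]|[bH hb]] //.
by rewrite bH; apply/asboolP.
Qed.

Local Notation tau := ((param x)%:A : L).

Lemma tau_neq0 : tau != 0.
Proof. exact: base_neq0 (param_neq0 x). Qed.

Lemma D_tau : D tau = if x is Some _ then 1 else - tau ^+ 2.
Proof.
have tauE := local_paramE x; rewrite -tauE.
have t0 : Defs.coord L != 0 by rewrite scaler_eq0 oner_eq0 orbF T_neq0.
case: x => [a|] /=.
  by have := DD (Defs.coord L - Defs.cst L a) (Defs.cst L a); rewrite subrK Dt Dc addr0 => <-.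
have := @derV _ L L^o D DM _ t0.
by rewrite Dt /= => ->; rewrite exprVn; apply: mulr1.
Qed.

Lemma D_tau_neq0 : D tau != 0.
Proof.
by rewrite D_tau; case: (x) tau_neq0 => [a|] t0; rewrite ?oner_neq0 // oppr_eq0 expf_neq0.
Qed.

Lemma val_D_tau : v (D tau) = if x is Some _ then 0 else 2 * e%:Z.
Proof.
rewrite D_tau; have := val_param; have := tau_neq0.
case: (x) => [a|] t0 vt; first by rewrite val1.
by rewrite valN // valX // vt.
Qed.

Lemma theta_factor_neq0 : tau / D tau != 0.
Proof. exact: mulf_neq0 tau_neq0 (invr_neq0 D_tau_neq0). Qed.

Lemma val_theta_factor : v (tau / D tau) = e%:Z - v (D tau).
Proof. by rewrite (valM hv tau_neq0 (invr_neq0 D_tau_neq0)) valV // val_param. Qed.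

(** The derivation [tau d/dtau]. *)
Definition theta (f : L) : L := D f * (tau / D tau).

Lemma thetaD f g : theta (f + g) = theta f + theta g.
Proof. by rewrite /theta DD mulrDl. Qed.

Lemma thetaM f g : theta (f * g) = f * theta g + g * theta f.
Proof. by rewrite /theta DM mulrDl !mulrA. Qed.

Lemma theta_const a : theta (c a) = 0.
Proof. by rewrite /theta Dc mul0r. Qed.

Lemma theta_tau : theta tau = tau.
Proof. by rewrite /theta mulrC divfK // D_tau_neq0. Qed.

Lemma theta_base f : f \in 1%VS -> vge v (v f) (theta f).
Proof.
move=> /vlineP[h ->] {f}; have [->|] := eqVneq h 0.
  by rewrite scale0r -(rmorph0 c) theta_const vge0.
move: h; apply: ratfun_ind.
- by move=> a _; rewrite theta_const vge0.
- move=> b; have -> : theta (tofrac 'X - cK b)%:A = tau / D tau.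
    have -> : (tofrac 'X - cK b)%:A = local_param L (Some b) by rewrite /= scalerBl.
    have := DD (Defs.coord L - Defs.cst L b) (Defs.cst L b); rewrite subrK Dt Dc addr0 /theta /= => <-.
    by rewrite mul1r.
  rewrite (vgeE v _ theta_factor_neq0) val_theta_factor val_D_tau.
  rewrite val_base (val_linear (valuation_ordK x) (ordK_const x) (isT : (0 < 1)%N) (ordK_param x)).
  by case: (x) => [a|]; first case: ifP; move: e; clear; lia.
- move=> f g f0 g0 hf hg.
  have fA0 := base_neq0 f0.
  have gA0 := base_neq0 g0.
  rewrite [(f * g)%:A](rmorphM (GRing.in_alg L)) thetaM (valM hv fA0 gA0).
  apply: vgeD => //; first exact: vgeM (vge_val _ _) hg.
  by rewrite addrC; apply: vgeM (vge_val _ _) hf.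
- move=> f f0 hf; have fA0 := base_neq0 f0.
  rewrite [(f^-1)%:A](fmorphV (GRing.in_alg L)) (valV hv).
  rewrite (@derV _ L L^o theta thetaM _ fA0).
  have v2 : v (f%:A ^- 2) = - (2 * v f%:A) by rewrite valV // valX.
  have := vgeM hv (vge_val v (f%:A ^- 2)) hf; rewrite v2 => h2.
  rewrite [X in vge _ _ X](mulNr (f%:A ^- 2) (theta f%:A)) (vgeN hv).
  by apply: vge_le h2; move: (v f%:A); clear; lia.
Qed.

Lemma dlog_theta f : f != 0 -> vge v 0 (dlog theta f).
Proof.
exact: (dlog_integral cbase galL u0 hX Xinj hm hv point_const point_residue
  (in_base _) ram_gt0 val_param dvd_val_base point_surj thetaD thetaM theta_const
  theta_tau theta_base).
Qed.

Lemma val_D_uniformizer s : v s = 1 -> D s != 0 /\ v (D s) = 1 + v (D tau) - e%:Z.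
Proof.
move=> vs; have [] := val_th_uniformizer cbase galL u0 hX Xinj hm hv point_const
  point_residue (in_base _) ram_gt0 val_param dvd_val_base point_surj thetaD thetaM
  theta_const theta_tau theta_base vs.
rewrite /theta mulf_eq0 negb_or => /andP[Ds q0]; split=> //; move: b.
rewrite valM // val_theta_factor.
by move: (v (D s)) (v (D tau)) e; clear; lia.
Qed.

Variables (Om : lmodType L) (d : L -> Om) (omega : Om).
Hypothesis hd : forall f, d f = D f *: d (Defs.coord L).
Hypothesis dt0 : d (Defs.coord L) != 0.
Hypothesis hw : omega = u *: d (Defs.coord L).

Lemma ord_formula : ord d v omega = v u - (1 + v (D tau) - e%:Z).
Proof.
have inj a b : a *: d (Defs.coord L) = b *: d (Defs.coord L) -> a = b.
  by move/eqP; rewrite -subr_eq0 -scalerBl scaler_eq0 (negPf dt0) orbF subr_eq0 => /eqP.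
have key s f : v s = 1 -> omega = f *: d s -> u = f * D s.
  by move=> vs wE; apply: inj; rewrite -hw wE hd scalerA.
apply: xget_unique; last first.
  move=> n [s [f [vs f0 wE ->]]]; have [Ds0 vDs] := val_D_uniformizer vs.
  by rewrite (key _ _ vs wE) valM // -vDs addrK.
have [s vs] := point_surj; have [Ds0 vDs] := val_D_uniformizer vs.
exists s, (u / D s); split=> //; first by rewrite mulf_neq0 ?invr_neq0.
  by rewrite hd scalerA divfK.
by rewrite valM ?invr_neq0 // valV // vDs.
Qed.

Variables (p : nat) (F : K).
Hypothesis p2 : (2 < p)%N.
Hypothesis uF : u ^+ p.-1 = F%:A.

(** The value of [(p - 1) (sigma_x - 1)]; the correction at infinity comes from the
    double pole of [dt]. *)
Definition excess (F : K) (x : option k) : int :=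
  ordK x F - (if x is Some _ then 0 else 2 * p.-1%:Z).

Lemma sigma_at_place :
  (ord d v omega + 1)%:~R / #|stabilizer v|%:R = 1 + (excess F x)%:~R / p.-1%:R :> rat.
Proof.
rewrite ord_formula card_point_stabilizer val_D_tau.
have vu : p.-1%:Z * v u = e%:Z * ordK x F by rewrite -val_base -uF valX.
have e0 : e%:R != 0 :> rat by rewrite pnatr_eq0 -lt0n ram_gt0.
have p0 : p.-1%:R != 0 :> rat by rewrite pnatr_eq0 -lt0n; move: p2; clear; lia.
have vuQ : p.-1%:R * (v u)%:~R = e%:R * (ordK x F)%:~R :> rat.
  by move/(congr1 (fun n : int => n%:~R : rat)): vu; rewrite !rmorphM.
have vuE : (v u)%:~R = e%:R * (ordK x F)%:~R / p.-1%:R :> rat.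
  by rewrite -vuQ mulrC mulKf.
rewrite /excess; case: (x) vuE => [a|] vuE; rewrite !(rmorphD, rmorphB, rmorphM) /= vuE.
  by field; rewrite e0 p0.
by field; rewrite e0 p0.
Qed.

(** A logarithmic form has at most a simple pole, because [theta] does not decrease
    orders. *)
Lemma excess_lower_bound f0 : f0 != 0 -> u = D f0 / f0 -> - p.-1%:Z <= excess F x.
Proof.
move=> f00 uE; have q0 := theta_factor_neq0.
have := dlog_theta f00; rewrite /dlog /theta mulrAC -uE (vgeE v 0 (mulf_neq0 u0 q0)).
rewrite valM // val_theta_factor val_D_tau.
have vu : p.-1%:Z * v u = e%:Z * ordK x F by rewrite -val_base -uF valX.
have := ram_gt0; rewrite /excess; move: (p.-1) (ordK x F) (v u) e vu => q o n r.
case: (x) => [a|]; clear; nia.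
Qed.

End AtAPlace.

End LocalInvariants.

(** * From a deformation datum to a divisor of degree [- 2 (p - 1)] *)

Section DatumExcess.

Variables (k : closedFieldType) (p : nat) (L : splittingFieldType {fraction {poly k}}).
Variables (Om : lmodType L) (d : L -> Om) (omega : Om).
Local Notation K := {fraction {poly k}}.
Local Notation cK := (@tofrac {poly k} \o polyC).
Local Notation c := (@GRing.in_alg _ L \o cK).
Local Notation H := ('Gal({:L} / 1)%g).
Hypothesis hp : p \in [pchar k].
Hypothesis p2 : (2 < p)%N.

Lemma differential_base : is_derivation d ->
  forall f, f \in 1%VS -> exists a, d f = a *: d (Defs.coord L).
Proof.
move=> [dD dM dc] _ /vlineP[h ->]; have [->|] := eqVneq h 0.
  by exists 0; rewrite scale0r scale0r -[0 in LHS](rmorph0 c) (dc 0).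
move: h; apply: ratfun_ind.
- by move=> a _; exists 0; rewrite scale0r; apply: dc.
- move=> b; exists 1; rewrite scale1r scalerBl -/(Defs.coord L) -/(Defs.cst L b).
  by have := dD (Defs.coord L - Defs.cst L b) (Defs.cst L b); rewrite subrK dc addr0 => ->.
- move=> f g f0 g0 [a ha] [b hb]; exists (f%:A * b + g%:A * a).
  by rewrite [(f * g)%:A](rmorphM (GRing.in_alg L)) dM ha hb scalerDl !scalerA.
- move=> f f0 [a ha]; exists (- f%:A ^- 2 * a).
  rewrite [(f^-1)%:A](fmorphV (GRing.in_alg L)) (derV dM (base_neq0 L f0)) ha.
  by rewrite scalerA.
Qed.

Lemma Fp_nat_inj (a b : 'F_p) : (a : nat)%:R = (b : nat)%:R :> k -> a = b.
Proof.
have pr := pcharf_prime hp.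
have lt (i : 'F_p) : (i < p)%N by have := ltn_ord i; rewrite [X in (_ < X)%N](Fp_cast pr).
wlog le : a b / (a <= b)%N => [W|].
  by case: (leqP a b) => [/W//|/ltnW/W + /esym]; move=> h /h.
move/esym/eqP; rewrite -subr_eq0 -natrB // -(dvdn_pcharf hp) => dvd.
apply: val_inj => /=; apply/eqP; rewrite eqn_leq le /= -subn_eq0.
by apply: contraTT dvd; rewrite -lt0n => gt; rewrite gtnNdvd // (leq_ltn_trans (leq_subr _ _)).
Qed.

(** The integers [(p - 1) (sigma_x - 1)] are the orders of the function [F] with
    [omega = u dt] and [u ^+ (p - 1) = F], corrected at infinity; logarithmic forms
    have at most simple poles, and [F] has degree 0. *)
Lemma datum_excess : is_kaehler d -> is_deformation_datum d p omega ->
  exists N : option k -> int,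
  [/\ forall x, sigma d omega x = 1 + (N x)%:~R / p.-1%:R,
      forall x, - p.-1%:Z <= N x &
      exists s : seq (option k), [/\ uniq s, forall x, x \notin s -> N x = 0
        & \sum_(x <- s) N x = - (2 * p.-1%:Z)]].
Proof.
move=> [hder _] [galL w0 [f0 f00 wE] [chi injchi hchi]].
have [dD dM dc] := hder.
have spanned := differentials_spanned galL dD dM (differential_base hder).
have dt0 : d (Defs.coord L) != 0.
  apply: contraNneq w0 => dt0; have [a ha] := spanned f0.
  by rewrite wE ha dt0 !scaler0.
have [D [hd DD DM]] := derivation_of_differential galL dD dM (differential_base hder) dt0.
have Dinj a b : a *: d (Defs.coord L) = b *: d (Defs.coord L) -> a = b.
  by move/eqP; rewrite -subr_eq0 -scalerBl scaler_eq0 (negPf dt0) orbF subr_eq0 => /eqP.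
have Dc a : D (c a) = 0.
  by apply: Dinj; rewrite -hd scale0r; apply: dc.
have Dt : D (Defs.coord L) = 1 by apply: Dinj; rewrite -hd scale1r.
pose u := D f0 / f0.
have uw : omega = u *: d (Defs.coord L) by rewrite wE hd scalerA mulrC.
have u0 : u != 0 by apply: contraNneq w0 => u0; rewrite uw u0 scale0r.
pose X (b : gal_of {:L}) : k := ((val (chi b) : 'F_p) : nat)%:R.
have hX b : b \in H -> b u = c (X b) * u.
  move=> bH; have [phi [_ hphi] phiw] := hchi b bH; apply: Dinj.
  have bt : b (Defs.coord L) = Defs.coord L.
    by apply: (fixed_gal _ bH); rewrite ?sub1v // in_base.
  rewrite -{1}bt -hphi -uw phiw uw scalerA; congr (_ * _ *: _).
  by rewrite [RHS](rmorph_nat c).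
have Xinj : {in H &, injective X}.
  move=> a b aH bH /Fp_nat_inj/val_inj; exact: (injmP injchi).
have pr := pcharf_prime hp.
have mp : (#|H| %| p.-1)%N.
  have cardU : #|[set: {unit 'F_p}]%G| = p.-1 by rewrite card_finField_unit (card_Fp pr).
  rewrite -cardU -(card_injm injchi (fintype.subxx _)).
  by apply: cardSg; apply: finset.subsetT.
have p10 : (0 < p.-1)%N by move: p2; clear; lia.
have hm : (#|H|%:R : k) != 0.
  rewrite -(dvdn_pcharf hp) gtnNdvd ?cardG_gt0 //.
  by rewrite (leq_ltn_trans (dvdn_leq p10 mp)) // ltn_predL prime_gt0.
have cbase a : c a \in 1%VS by apply: in_base.
have /vlineP[G uG] := kummer_power cbase galL u0 hX.
have G0 : G != 0.
  by apply: contraTneq (expf_neq0 #|H| u0) => G0; rewrite uG G0 scale0r eqxx.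
have uF : u ^+ p.-1 = (G ^+ (p.-1 %/ #|H|))%:A.
  by rewrite [RHS](rmorphXn (GRing.in_alg L)) /= -uG -exprM mulnC divnK.
set F := G ^+ _ in uF; have F0 : F != 0 := expf_neq0 _ G0.
have place (x : option k) : exists v : L -> int, is_point v /\ lies_above v x.
  have [v [hv vc vx vs]] := place_exists (kummer_poly_surj cbase galL u0 hX Xinj hm)
    (fun P => kummer_poly_ker u0 hX Xinj uG) (cardG_gt0 _) hm u0 G0 x.
  exists v; split; last by rewrite /lies_above local_paramE.
  by case: hv => vM vD v0; split.
have atplace v (x : option k) (hpt : @is_point k L v) (hab : lies_above v x) :=
  sigma_at_place hpt hab galL u0 hX Xinj hm DD DM Dc Dt hd dt0 uw p2 uF.
exists (excess p F); split=> [x|x|].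
- apply: xget_unique.
    by have [v [hpt hab]] := place x; exists v; split=> //; rewrite (atplace v x hpt hab).
  by move=> _ [v [hpt hab ->]]; rewrite (atplace v x hpt hab).
- have [v [hpt hab]] := place x.
  exact: (excess_lower_bound hpt hab galL u0 hX Xinj hm DD DM Dc Dt uF f00 erefl).
have [s [sF sumF]] := degree_ordK F0.
have us := undup_uniq (None :: s).
have sub : {subset s <= undup (None :: s)}.
  by move=> y ys; rewrite mem_undup inE ys orbT.
exists (undup (None :: s)); split=> // [x|].
  rewrite mem_undup inE negb_or => /andP[xN xs]; rewrite /excess sF //.
  by case: x xN {xs} => // a _; rewrite subr0.
rewrite sumrB sumF // sub0r; congr (- _).
have Nin : None \in undup (None :: s) by rewrite mem_undup inE.
by rewrite (bigD1_seq None) //= big1 ?addr0 // => -[].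
Qed.

End DatumExcess.

(** * Strength *)

Lemma sum_indicator (T : Type) (P : pred T) (s : seq T) :
  \sum_(y <- s) (P y)%:Z = (count P s)%:Z.
Proof. by elim: s => [|y s IH]; rewrite ?big_nil // big_cons IH. Qed.

Section Counting.

(** In positive characteristic [ratr] is not a morphism: it is computed from the
    reduced fraction, whose denominator divides [b]. *)
Lemma ratr_fraction (F : fieldType) (a b : int) : b%:~R != 0 :> F ->
  ratr (a%:~R / b%:~R : rat) = a%:~R / b%:~R :> F.
Proof.
move=> b0; have b0' : b != 0 by apply: contraNneq b0 => ->.
set q : rat := _ / _; have bQ : b%:~R != 0 :> rat by rewrite intr_eq0.
have E : numq q * b = a * denq q.
  apply: (@intr_inj rat); rewrite !rmorphM /= numqE /q.
  by rewrite mulrAC divfK.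
have dF : (denq q)%:~R != 0 :> F.
  apply: contraNneq b0 => d0.
  have /dvdzP[m bE] : (denq q %| b)%Z.
    rewrite -(Gauss_dvdzr b (_ : coprimez (denq q) (numq q))).
      by rewrite E dvdz_mull.
    by rewrite coprimezE coprime_sym coprime_num_den.
  by rewrite bE intrM d0 mulr0.
rewrite /ratr; apply/eqP; rewrite eqr_div // -!rmorphM E.
by [].
Qed.

Variables (k : closedFieldType) (p : nat) (L : splittingFieldType {fraction {poly k}}).
Variables (Om : lmodType L) (d : L -> Om) (omega : Om).
Hypothesis pr : prime p.
Hypothesis p2 : (2 < p)%N.
Variable N : option k -> int.
Hypothesis hN : forall x, sigma d omega x = 1 + (N x)%:~R / p.-1%:R.
Hypothesis N_lower : forall x, - p.-1%:Z <= N x.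

Lemma p1E : p.-1%:R = p%:R - 1 :> rat.
Proof. by rewrite -subn1 natrB // ltnW // ltnW. Qed.

Lemma p1_neq0 : p.-1%:R != 0 :> rat.
Proof. by rewrite pnatr_eq0 -lt0n; move: p2; clear; lia. Qed.

Lemma excessE x : (p%:R - 1) * (sigma d omega x - 1) = (N x)%:~R :> rat.
Proof. by rewrite hN -p1E addrC addKr mulrC divfK // p1_neq0. Qed.

Lemma criticalE x : critical d omega x <-> N x != 0.
Proof.
rewrite /critical hN; split=> [h|h].
  by apply: contra_notN h => /eqP ->; rewrite mul0r addr0.
move=> /eqP; rewrite -subr_eq0 addrC addKr mulf_eq0 invr_eq0 (negPf p1_neq0) orbF.
by rewrite intr_eq0 (negPf h).
Qed.

Lemma supersingularE x : supersingular d p omega x <-> N x = 2.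
Proof.
rewrite /supersingular criticalE hN -p1E.
have -> : p%:R + 1 = p.-1%:R + 2%:R :> rat by rewrite p1E; ring.
split=> [[_ /eqP]|->]; last by split=> //; rewrite [RHS]mulrDl divff ?p1_neq0.
rewrite [eqbRHS]mulrDl divff ?p1_neq0 // (inj_eq (addrI _)) (inj_eq (mulIf _)) ?invr_eq0 ?p1_neq0 //.
by rewrite -[2%:R]/(2%:~R) eqr_int => /eqP.
Qed.

Lemma Fp_p1 : p.-1%:R = -1 :> 'F_p.
Proof. by apply/eqP; rewrite -addr_eq0 natr1 prednK ?prime_gt0 // pchar_Fp_0. Qed.

Lemma residueE x : residue d p omega x = 1 - (N x)%:~R.
Proof.
have sE : sigma d omega x = (p.-1%:Z + N x)%:~R / (p.-1%:Z)%:~R :> rat.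
  by rewrite hN rmorphD [RHS]mulrDl divff ?p1_neq0.
have m1 : (p.-1%:Z)%:~R = -1 :> 'F_p := Fp_p1.
rewrite /residue sE ratr_fraction; last by rewrite m1 oppr_eq0 oner_neq0.
by rewrite intrD m1 invrN1 mulrN1 opprD opprK.
Qed.

Lemma spikeE x : spike d p omega x <-> N x != 0 /\ (N x)%:~R = 0 :> 'F_p.
Proof.
rewrite /spike criticalE residueE; split=> -[N0 h]; split=> //; last first.
  by rewrite h subr0.
by apply: oppr_inj; apply: (@addrI _ 1); rewrite h oppr0 addr0.
Qed.

Definition singular x := ((N x)%:~R != 0 :> 'F_p) && (N x != 2).

Lemma singularE x : singularity d p omega x <-> singular x.
Proof.
split=> [[/criticalE N0 n2 sp]|/andP[h n2]].
  apply/andP; split; last by apply/eqP => /supersingularE.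
  by apply: contra_notN sp => /eqP h; apply/spikeE.
split; first by apply/criticalE; apply: contraNneq h => ->.
  by move=> /supersingularE/eqP; rewrite (negPf n2).
by move=> /spikeE[_ /eqP]; rewrite (negPf h).
Qed.

Definition weight x : int := if N x == 2 then 0 else if singular x then N x + p.-1%:Z else N x.

Lemma local_strengthE x : critical d omega x -> local_strength d p omega x = (weight x)%:~R.
Proof.
rewrite /local_strength /weight => /criticalE N0; case: asboolP => [/supersingularE ->|nss] //.
have n2 : N x != 2 by apply: contra_notN nss => /eqP h; apply/supersingularE.
rewrite (negPf n2); case: asboolP => [/spikeE[_ h]|nsp].
  by rewrite /singular h eqxx excessE.
have -> : singular x.
  by rewrite /singular n2 andbT; apply: contra_notN nsp => /eqP h; apply/spikeE.
rewrite intrD -excessE [X in _ = _ + X]p1E; ring.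
Qed.

Lemma weightE x : weight x = N x + (singular x)%:Z * p.-1%:Z - (N x == 2)%:Z * 2.
Proof.
rewrite /weight; case: eqP => [n2|_]; last by case: ifP => _ /=; clear; lia.
by rewrite /singular n2 eqxx andbF /=.
Qed.

(** A spike has weight [N x], a multiple of [p], and a singularity has weight
    congruent to [N x - 1]. *)
Lemma weight_Fp x : (weight x)%:~R = - ((singular x)%:R * residue d p omega x) :> 'F_p.
Proof.
rewrite residueE /weight; case: eqP => [n2|n2].
  by rewrite /singular n2 andbF mul0r oppr0.
case: ifP => [_|]; first by rewrite intrD -[(p.-1%:Z)%:~R]/(p.-1%:R) Fp_p1 mul1r opprB.
rewrite /singular (introF eqP n2) andbT => /negbFE/eqP ->.
by rewrite mul0r oppr0.
Qed.

Lemma p_dvd_int (a : int) : a%:~R = 0 :> 'F_p -> (p %| `|a|)%N.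
Proof.
have cp := pchar_Fp pr; case: a => n; first by move/eqP; rewrite -pmulrn -(dvdn_pcharf cp).
by rewrite NegzE mulrNz => /eqP; rewrite oppr_eq0 -pmulrn -(dvdn_pcharf cp) abszN.
Qed.

(** At a singularity the weight is a nonnegative integer congruent to [- alpha], and
    at a spike a multiple of [p] greater than [- p]. *)
Lemma weight_bound x :
  (if singular x && (residue d p omega x != 0)
   then (p - residue d p omega x)%N%:Z else 0) <= weight x.
Proof.
have p0 := prime_gt0 pr; have low := N_lower x.
have wFp := weight_Fp x; set a := residue _ _ _ _ in wFp *.
have ap : (a < p)%N by have := ltn_ord a; rewrite [X in (_ < X)%N](Fp_cast pr).
have w0 : 0 <= weight x.
  rewrite /weight; case: eqP => // n2; case: ifP => [_|]; first by move: low; clear; lia.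
  rewrite /singular (introF eqP n2) andbT => /negbFE/eqP/p_dvd_int.
  rewrite leNgt => dvd; apply/negP => N0; have := dvdn_leq _ dvd.
  by move: low N0 p0 p2; clear; lia.
case: ifP => // /andP[sx a0]; rewrite sx mul1r in wFp.
have : (p %| absz (weight x + (a : nat)%:Z)%R)%N.
  apply: p_dvd_int; rewrite intrD wFp -[((a : nat)%:Z)%:~R]/((a : nat)%:R) natr_Zp.
  by rewrite addNr.
have a1 : (0 < a)%N by rewrite lt0n; apply: contra a0 => /eqP h; apply/eqP/val_inj.
move/dvdn_leq; move: w0 a1 ap; move: (weight x) (nat_of_ord a) => w n; clear; lia.
Qed.

Variable s : seq (option k).
Hypothesis us : uniq s.
Hypothesis hs : forall x, x \notin s -> N x = 0.

Lemma strengthE : strength d p omega = (\sum_(x <- s) weight x)%:~R.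
Proof.
have in_s x : N x != 0 -> x \in s by apply: contraR => /hs ->.
rewrite /strength rmorph_sum /=.
rewrite (fsbig_fwiden [seq x <- s | N x != 0]) ?filter_uniq //; last 2 first.
- by move=> x /criticalE h /=; rewrite mem_filter h in_s.
- by move=> x [/=]; rewrite mem_filter => /andP[/criticalE h _] [].
rewrite big_filter [RHS](bigID (fun x => N x != 0)) /= [X in _ = _ + X]big1 ?addr0.
  by apply: eq_bigr => x /criticalE; apply: local_strengthE.
move=> x; rewrite negbK /weight /singular => /eqP ->.
by rewrite mulr0z eqxx.
Qed.

Lemma card_supersingular n : ([set y | supersingular d p omega y] #= `I_n)%card ->
  count (fun x => N x == 2) s = n.
Proof.
move=> hn; have uf := filter_uniq (fun x => N x == 2) us.
rewrite -size_filter -(undup_id uf) -finmap.card_fseq; apply/card_eq_fsetP.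
apply: etrans hn; congr (_ #= _)%card.
apply/seteqP; split=> x /=; rewrite !inE mem_filter.
  by move=> /andP[/eqP h _]; apply/supersingularE.
move=> /supersingularE h; rewrite h eqxx /=; apply: contraT => /hs.
by rewrite h.
Qed.

Variables (r : nat) (x : 'I_r -> option k).
Hypothesis xinj : injective x.
Hypothesis hx : range x = [set y | singularity d p omega y].

Lemma perm_singular : perm_eq [seq x i | i <- enum 'I_r] [seq y <- s | singular y].
Proof.
apply: uniq_perm => [||y]; last 1 first; rewrite ?filter_uniq ?map_inj_uniq -?enumT ?enum_uniq //.
rewrite mem_filter; apply/mapP/andP => [[i _ ->]|[sy ys]].
  have : [set y | singularity d p omega y] (x i) by rewrite -hx; exists i.
  move=> /singularE sx; split=> //; apply: contraT => /hs Nx.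
  by move: sx; rewrite /singular Nx mulr0z eqxx.
have : range x y by rewrite hx; apply/singularE.
by move=> [i _ <-]; exists i; rewrite ?mem_enum.
Qed.

Lemma sum_singular (R : nmodType) (f : option k -> R) :
  \sum_(y <- s | singular y) f y = \sum_(i < r) f (x i).
Proof. by rewrite -big_filter -(perm_big _ perm_singular) big_map big_enum. Qed.

Lemma count_singular : count singular s = r.
Proof. by rewrite -size_filter -(perm_size perm_singular) size_map size_enum_ord. Qed.

End Counting.

Theorem lemma4p3 (k : closedFieldType) (p : nat)
    (L : splittingFieldType {fraction {poly k}})
    (Om : lmodType L) (d : L -> Om) (omega : Om)
    (r nss : nat) (x : 'I_r -> option k) :
  p \in [pchar k] -> (2 < p)%N ->
  is_kaehler d ->
  is_deformation_datum d p omega ->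
  ~ trivial_datum d p omega ->
  injective x ->
  range x = [set y | singularity d p omega y] ->
  ([set y | supersingular d p omega y] #= `I_nss)%card ->
  let alpha (i : 'I_r) : 'F_p := residue d p omega (x i) in
  let n : rat := strength d p omega in
  [/\ n = (r%:R - 2) * (p%:R - 1) - 2 * nss%:R,
      exists N : int,
        [/\ n = N%:~R, (2 %| N)%Z
          & N%:~R = - (\sum_(i < r) alpha i) :> 'F_p]
    & \sum_(i < r | alpha i != 0) (p - alpha i)%N%:R <= n].
Proof.
move=> hp p2 kaehler datum _ xinj hx hss alpha n.
have pr := pcharf_prime hp.
have [N [hN N_lower [s [us hs sumN]]]] := datum_excess hp p2 kaehler datum.
have nE : n = (\sum_(y <- s) weight p N y)%:~R := strengthE pr p2 hN us hs.
have wE : \sum_(y <- s) weight p N y = (r%:Z - 2) * p.-1%:Z - 2 * nss%:Z.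
  rewrite (eq_bigr _ (fun y _ => weightE p N y)) !big_split /= sumrN.
  rewrite sumN -!mulr_suml !sum_indicator (count_singular pr p2 hN us hs xinj hx).
  rewrite (card_supersingular p2 hN us hs hss); ring.
have odd_p : odd p by move: (pr) p2; case: (p) => [|[|[|?]]] //; case/even_prime => // ->.
split.
- by rewrite nE wE intrB !intrM intrB -(p1E p2).
- exists (\sum_(y <- s) weight p N y); split=> //.
    rewrite wE rpredB ?(dvdz_mulr nss%:Z) // dvdz_mull // dvdzE /=.
    by move: odd_p p2; clear; lia.
  rewrite rmorph_sum -sumrN -(sum_singular pr p2 hN us hs xinj hx (fun y => - residue d p omega y)).
  rewrite [RHS]big_mkcond /=; apply: eq_bigr => y _; rewrite (weight_Fp pr p2 hN).
  by case: ifP => _; rewrite ?mul1r ?mul0r ?oppr0.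
pose f y : rat := if residue d p omega y != 0 then (p - residue d p omega y)%N%:R else 0.
rewrite nE big_mkcond -/(\sum_(i < r) f (x i)).
rewrite -(sum_singular pr p2 hN us hs xinj hx f) big_mkcond rmorph_sum /=.
apply: ler_sum => y _; have := weight_bound pr p2 hN N_lower y.
by rewrite /f -(ler_int rat); case: (singular p N y) => //=; case: (_ != 0).
Qed.
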